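(* There is an absolute constant $C>0$ such that the following holds. Let $G$ be a compact Abelian group, let $f \in A(G)$ be non-zero, let $\epsilon \in (0,1]$, and let $\Gamma=\{\gamma \in \widehat{G}:|\widehat{f}(\gamma)| \geq \epsilon \|f\|_\infty\}$. Then there is a set of characters $\Lambda\subset\widehat G$ such that $\Gamma \subset \langle \Lambda \rangle$ and $$|\Lambda| \leq C \epsilon^{-1} \left(1+\log \left(\|f\|_{A(G)}\|f\|_\infty^{-1}\right)\right).$$
   Context: For a compact Abelian group $G$, $\mu_G$ is Haar measure with $\mu_G(G)=1$, and $\widehat G$ is the discrete dual group of continuous homomorphisms $\gamma:G\to S^1$, written additively. For $f\in L^1(G)$, $\widehat f(\gamma)=\int_G f(x)\overline{\gamma(x)}\,d\mu_G(x)$. The space $A(G)$ is $\{f\in L^1(G):\|\widehat f\|_1<\infty\}$ with norm $\|f\|_{A(G)}:=\|\widehat f\|_1=\sum_{\gamma\in\widehat G}|\widehat f(\gamma)|$; $\|f\|_\infty$ is the $L^\infty(G)$ norm. For a set $\Lambda\subset\widehat G$, $\langle\Lambda\rangle$ is the set of all finite sums $\sum_{\lambda\in\Lambda}m_\lambda\lambda$ with $m_\lambda\in\{-1,0,1\}$ and only finitely many $m_\lambda$ non-zero. *)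

(* Defs.v *)
From HB Require Import structures.
From mathcomp Require Import all_boot all_order all_algebra.
From mathcomp Require Import all_classical all_reals all_analysis.
From mathcomp Require Import complex.

Set Implicit Arguments.
Unset Strict Implicit.
Unset Printing Implicit Defensive.

Import Order.TTheory GRing.Theory Num.Theory.
Import numFieldTopology.Exports numFieldNormedType.Exports.

Local Open Scope classical_set_scope.
Local Open Scope ring_scope.

(* The library asks the carrier of a generated sigma-algebra to be pointed,
   which topologicalZmodType is not; 0 is the distinguished point. *)
Definition pointed_group (G : topologicalZmodType) : Type := G.
HB.instance Definition _ (G : topologicalZmodType) :=
  Choice.on (pointed_group G).
HB.instance Definition _ (G : topologicalZmodType) :=
  isPointed.Build (pointed_group G) (0 : G).

Definition borel (G : topologicalZmodType) : Type :=
  g_sigma_algebraType (@open G : set (set (pointed_group G))).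

Section haar.
Context {R : realType} {G : topologicalZmodType}.
Local Open Scope ereal_scope.

(* Regularity is part of the definition of Haar measure: without it, a
   translation-invariant Borel probability measure need not be unique when G
   is not second countable. *)
Record is_haar (mu : probability (borel G) R) : Prop := IsHaar {
  haar_invariant : forall (a : G) (A : set (borel G)), measurable A ->
    mu ((fun x : G => (a + x)%R) @` A) = mu A ;
  haar_outer_regular : forall A : set (borel G), measurable A ->
    mu A = ereal_inf [set mu U | U in [set U : set G | open U /\ A `<=` U]] ;
  haar_inner_regular : forall U : set G, open U ->
    mu U = ereal_sup [set mu K | K in
      [set K : set G | compact K /\ measurable (K : set (borel G)) /\
                       K `<=` U]] }.

End haar.

Section dual_group.
Context {R : realType} {G : topologicalZmodType}.

(* R[i] gets its norm topology only through the alias R[i]^o. *)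
Record is_character (gamma : G -> R[i]) : Prop := IsCharacter {
  character_continuous : continuous (gamma : G -> R[i]^o) ;
  character_norm : forall x, `|gamma x| = 1 ;
  characterD : forall x y, gamma (x + y) = gamma x * gamma y }.

End dual_group.

Record dual (R : realType) (G : topologicalZmodType) := Dual {
  dual_fun :> G -> R[i] ;
  dualP : is_character dual_fun }.

HB.instance Definition _ (R : realType) (G : topologicalZmodType) :=
  gen_eqMixin (dual R G).
HB.instance Definition _ (R : realType) (G : topologicalZmodType) :=
  gen_choiceMixin (dual R G).

Section dual_zmodule.
Context {R : realType} {G : topologicalZmodType}.
Implicit Types gamma chi : dual R G.

Lemma dual_eq gamma chi : (forall x, gamma x = chi x) -> gamma = chi.
Proof.
case: gamma chi => [f fP] [g gP] /= /funext fg; subst g.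
by rewrite (Prop_irrelevance fP gP).
Qed.

Lemma dual_neq0 gamma x : gamma x != 0.
Proof. by rewrite -normr_eq0 (character_norm (dualP gamma)) oner_eq0. Qed.

Fact dual0_subproof : is_character (fun _ : G => 1 : R[i]).
Proof.
split=> [x|x|x y]; [exact: cvg_cst|exact: normr1|by rewrite mulr1].
Qed.

Fact dualD_subproof gamma chi : is_character (fun x => gamma x * chi x).
Proof.
have [[gc gn gD] [cc cn cD]] := (dualP gamma, dualP chi).
split=> [x|x|x y]; first by apply: cvgM; [exact: gc|exact: cc].
  by rewrite normrM gn cn mulr1.
by rewrite gD cD mulrACA.
Qed.

Fact dualN_subproof gamma : is_character (fun x => (gamma x)^-1).
Proof.
have [gc gn gD] := dualP gamma.
split=> [x|x|x y]; first by apply: cvgV; [exact: dual_neq0|exact: gc].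
  by rewrite normrV ?unitfE ?dual_neq0// gn invr1.
by rewrite gD invfM.
Qed.

Definition dual0 : dual R G := Dual dual0_subproof.
Definition dualD gamma chi : dual R G := Dual (dualD_subproof gamma chi).
Definition dualN gamma : dual R G := Dual (dualN_subproof gamma).

Fact dualDA : associative dualD.
Proof. by move=> a b c; apply: dual_eq => x /=; rewrite mulrA. Qed.

Fact dualDC : commutative dualD.
Proof. by move=> a b; apply: dual_eq => x /=; rewrite mulrC. Qed.

Fact dual0D : left_id dual0 dualD.
Proof. by move=> a; apply: dual_eq => x /=; rewrite mul1r. Qed.

Fact dualND : left_inverse dual0 dualN dualD.
Proof. by move=> a; apply: dual_eq => x /=; rewrite mulVf ?dual_neq0. Qed.

End dual_zmodule.

(* The group law of the dual is pointwise multiplication, written additively. *)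
HB.instance Definition _ (R : realType) (G : topologicalZmodType) :=
  GRing.isZmodule.Build (dual R G)
    (@dualDA R G) (@dualDC R G) (@dual0D R G) (@dualND R G).

Section fourier.
Context {R : realType} {G : topologicalZmodType}.
Variable mu : probability (borel G) R.
Implicit Types f : borel G -> R[i].

(* The norm of R[i] takes its values in R[i], with zero imaginary part. *)
Definition cabs (z : R[i]) : R := complex.Re `|z|.

Definition cintegrable f : Prop :=
  mu.-integrable setT (fun x => (complex.Re (f x))%:E) /\
  mu.-integrable setT (fun x => (complex.Im (f x))%:E).

Definition cintegral f : R[i] :=
  Complex (\int[mu]_(x in setT) complex.Re (f x))%R
          (\int[mu]_(x in setT) complex.Im (f x))%R.

Definition fourier f (gamma : dual R G) : R[i] :=
  cintegral (fun x => f x * conjc (gamma x)).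

Definition A_norm f : \bar R :=
  \esum_(gamma in [set: dual R G]) (cabs (fourier f gamma))%:E.

Definition in_A f : Prop := cintegrable f /\ (A_norm f < +oo)%E.

Definition Linfty_norm f : \bar R :=
  ('N[mu]_(+oo)[(fun x => (cabs (f x))%:E)])%E.

Definition large_spectrum f (eps : R) : set (dual R G) :=
  [set gamma |
    (eps%:E * Linfty_norm f <= (cabs (fourier f gamma))%:E)%E].

End fourier.

Definition signed_span {R : realType} {G : topologicalZmodType}
    (L : set (dual R G)) : set (dual R G) :=
  [set gamma | exists m : dual R G -> int,
    [/\ forall l, m l \in [:: -1; 0; 1],
        finite_set (L `&` [set l | m l != 0]) &
        gamma = \sum_(l \in L) l *~ m l]].

(* Main.v *)
Require Import Defs.
From HB Require Import structures.
From mathcomp Require Import all_boot all_order all_algebra.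
From mathcomp Require Import all_classical all_reals all_analysis.
From mathcomp Require Import qpoly measurable_realfun ess_sup_inf.
From mathcomp Require Import complex finmap ring lra zify.

(** Let M be the essential supremum of |f| and A the norm of f in A(G).

    The set Lambda is a dissociated family of characters of maximal length in
    the large spectrum Gamma, dissociated meaning that no nontrivial
    combination with coefficients -1, 0, 1 vanishes.  By maximality every
    element of Gamma solves such a relation with Lambda, so Gamma is contained
    in the span of Lambda (exists_dissociated_span).  As |f^(lambda)| >= eps *
    M on Gamma, the length of Lambda is at most (eps * M)^-1 times the sum of
    |f^| over Lambda, and everything rests on the bound

      sum_(lambda in Lambda) |f^(lambda)| <= 36 * M * (1 + ln (A / M))

    (sum_fourier_dissociated_le).  For phases om(lambda) of modulus one,
    consider the Riesz products p_t = prod (1 + t * Re (om(lambda) * lambda)),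
    for t in [-1, 1].  They are nonnegative, and have mean one because Lambda
    is dissociated, so Q(t) = int f p_t is a polynomial in t with |Q| <= M on
    [-1, 1].  Expanding the product into words over the alphabet {-1, 0, 1},
    the words that represent a given character have total weight at most one,
    being a Fourier coefficient of a Riesz product (sum_words_le1); hence the
    coefficients of Q have total mass at most A.  Its linear coefficient is
    the integral of f against sum Re (om(lambda) * lambda), from which
    suitable phases recover the sum of |f^|.  The degree of Q is not
    controlled, but cutting Q off at degree of order ln (A / M) on [-1/2, 1/2]
    costs only an error of order M, and a Bernstein inequality |P'(0)| <= C *
    deg P * max |P| gives the bound (linear_coef_le_ln).  That inequality
    comes from an explicit Lagrange interpolation formula at the odd multiples
    of 1 / (4m).

    The right-hand side must also be nonnegative, which requires M <= A
    (sup_le_A_norm): f coincides almost everywhere with the sum of its Fourier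
    series.  This is the completeness of the characters of a compact abelian
    group, proved here from the Haar integral.  For a hermitian continuous
    kernel k, the normalized convolution powers of k * k converge uniformly to
    a nonzero continuous convolution idempotent u, the projection onto the top
    eigenspace (power_iteration).  The squared norm of a nonzero idempotent is
    at least one, so there is a minimal idempotent below u; its ideal is a
    line, stable under translations, hence spanned by a character
    (minimal_idem_character).  So a nonzero continuous function has a nonzero
    Fourier coefficient; bounded functions follow by convolution with
    continuous functions, Urysohn's lemma and the regularity of Haar measure
    (fourier_ae_inj).  Fubini's theorem is used for continuous kernels only,
    which are uniform limits of step kernels (fubini_cont). *)

Set Implicit Arguments.
Unset Strict Implicit.
Unset Printing Implicit Defensive.

Import Order.TTheory GRing.Theory Num.Theory.
Import numFieldTopology.Exports numFieldNormedType.Exports.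

Local Open Scope classical_set_scope.
Local Open Scope ring_scope.

(** * Complex numbers and continuous complex functions *)

Section complex_numbers.
Context {R : realType}.
Implicit Types z w : R[i].

Lemma cabsE z : cabs z = Num.sqrt (complex.Re z ^+ 2 + complex.Im z ^+ 2).
Proof. by case: z. Qed.

Lemma normr_cabs z : `|z| = (cabs z)%:C%C.
Proof. by case: z. Qed.

Lemma cabs_ge0 z : 0 <= cabs z.
Proof. by rewrite cabsE sqrtr_ge0. Qed.

Lemma cabs_sqr z : cabs z ^+ 2 = complex.Re z ^+ 2 + complex.Im z ^+ 2.
Proof. by rewrite cabsE sqr_sqrtr// addr_ge0// sqr_ge0. Qed.

Lemma cabsM z w : cabs (z * w) = cabs z * cabs w.
Proof. by apply: complexI; rewrite rmorphM /= -!normr_cabs normrM. Qed.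

Lemma cabsD z w : cabs (z + w) <= cabs z + cabs w.
Proof. by rewrite -lecR rmorphD /= -!normr_cabs ler_normD. Qed.

Lemma cabsN z : cabs (- z) = cabs z.
Proof. by rewrite /cabs normrN. Qed.

Lemma cabs_distC z w : cabs (z - w) = cabs (w - z).
Proof. by rewrite -cabsN opprB. Qed.

Lemma cabs0 : cabs (0 : R[i]) = 0.
Proof. by rewrite /cabs normr0. Qed.

Lemma cabs1 : cabs (1 : R[i]) = 1.
Proof. by rewrite /cabs normr1. Qed.

Lemma cabs_eq0 z : (cabs z == 0) = (z == 0).
Proof. by rewrite -[RHS]normr_eq0 normr_cabs eq_complex /= eqxx andbT. Qed.

Lemma cabs_real (r : R) : cabs r%:C%C = `|r|.
Proof. by rewrite cabsE /= expr0n /= addr0 sqrtr_sqr. Qed.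

Lemma cabsJ z : cabs (conjc z) = cabs z.
Proof. by case: z => a b; rewrite !cabsE /= sqrrN. Qed.

Lemma cabsX z n : cabs (z ^+ n) = cabs z ^+ n.
Proof. by elim: n => [|n IH]; rewrite ?expr0 ?cabs1// !exprS cabsM IH. Qed.

Lemma cabsV z : cabs z^-1 = (cabs z)^-1.
Proof.
have [->|z0] := eqVneq z 0; first by rewrite invr0 cabs0 invr0.
have c0 : cabs z != 0 by rewrite cabs_eq0.
by apply: (mulfI c0); rewrite -cabsM !divff// cabs1.
Qed.

Lemma cabs_sum (I : Type) (r : seq I) (P : pred I) (F : I -> R[i]) :
  cabs (\sum_(i <- r | P i) F i) <= \sum_(i <- r | P i) cabs (F i).
Proof.
elim/big_ind2 : _ => [|x a y b xa yb|//]; first by rewrite cabs0.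
by rewrite (le_trans (cabsD _ _))// lerD.
Qed.

Lemma mulcJ z : z * conjc z = (cabs z ^+ 2)%:C%C.
Proof.
case: z => a b; rewrite cabs_sqr; apply/eqP; rewrite eq_complex /=.
by apply/andP; split; apply/eqP; ring.
Qed.

Lemma Re_le_cabs z : `|complex.Re z| <= cabs z.
Proof. by rewrite -lecR -normr_cabs normc_ge_Re. Qed.

Lemma Im_le_cabs z : `|complex.Im z| <= cabs z.
Proof.
by rewrite cabsE -sqrtr_sqr ler_wsqrtr// lerDr sqr_ge0.
Qed.

Lemma cabs_le_ReIm z : cabs z <= `|complex.Re z| + `|complex.Im z|.
Proof.
rewrite cabsE -[leRHS]ger0_norm ?addr_ge0// -sqrtr_sqr ler_wsqrtr//.
by rewrite sqrrD !real_normK ?num_real// addrAC lerDl mulrn_wge0 ?mulr_ge0.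
Qed.

Lemma cReD z w : complex.Re (z + w) = complex.Re z + complex.Re w.
Proof. by case: z; case: w. Qed.
Lemma cImD z w : complex.Im (z + w) = complex.Im z + complex.Im w.
Proof. by case: z; case: w. Qed.
Lemma cReM z w : complex.Re (z * w) =
  complex.Re z * complex.Re w - complex.Im z * complex.Im w.
Proof. by case: z; case: w. Qed.
Lemma cImM z w : complex.Im (z * w) =
  complex.Re z * complex.Im w + complex.Im z * complex.Re w.
Proof. by case: z; case: w. Qed.
Lemma cReN z : complex.Re (- z) = - complex.Re z.
Proof. by case: z. Qed.
Lemma cImN z : complex.Im (- z) = - complex.Im z.
Proof. by case: z. Qed.
Lemma cReJ z : complex.Re (conjc z) = complex.Re z.
Proof. by case: z. Qed.
Lemma cImJ z : complex.Im (conjc z) = - complex.Im z.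
Proof. by case: z. Qed.

Lemma realcB (x y : R) : (x - y)%:C%C = x%:C%C - y%:C%C :> R[i].
Proof. exact: rmorphB. Qed.

Lemma realcD (x y : R) : (x + y)%:C%C = x%:C%C + y%:C%C :> R[i].
Proof. exact: rmorphD. Qed.

Lemma realcM (x y : R) : (x * y)%:C%C = x%:C%C * y%:C%C :> R[i].
Proof. exact: rmorphM. Qed.

Lemma realcX (x : R) n : (x ^+ n)%:C%C = x%:C%C ^+ n :> R[i].
Proof. exact: rmorphXn. Qed.

Lemma conjcM z w : conjc (z * w) = conjc z * conjc w.
Proof. exact: rmorphM. Qed.

Lemma eqcP z w : complex.Re z = complex.Re w ->
  complex.Im z = complex.Im w -> z = w.
Proof. by case: z w => a b [c d] /= -> ->. Qed.

Lemma cabs_le_eq0 z : (forall e : R, 0 < e -> cabs z <= e) -> z = 0.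
Proof.
move=> h; apply/eqP; rewrite -cabs_eq0 eq_le cabs_ge0 andbT.
by apply/ler_addgt0Pl => e e0; rewrite addr0 h.
Qed.

End complex_numbers.

Section continuous_complex_functions.
Context {R : realType}.

(** Continuity is expressed through real and imaginary parts, so that all the
    topology takes place in the real field. *)
Definition cont {T : topologicalType} (f : T -> R[i]) : Prop :=
  continuous (fun x => complex.Re (f x)) /\
  continuous (fun x => complex.Im (f x)).

Variable T : topologicalType.
Implicit Types f g : T -> R[i].

Lemma contP f : cont f <->
  forall x (e : R), 0 < e -> \forall y \near x, cabs (f y - f x) <= e.
Proof.
split=> [[cR cI] x e e0|h].
  have e2 : 0 < e / 2 by rewrite divr_gt0.
  have /cvgrPdist_le/(_ _ e2) h1 := cR x.
  have /cvgrPdist_le/(_ _ e2) h2 := cI x.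
  near=> y; apply: (le_trans (cabs_le_ReIm _)).
  rewrite [leRHS]splitr lerD// ?cReD ?cImD ?cReN ?cImN distrC; near: y.
    exact: h1.
  exact: h2.
split=> x; apply/cvgrPdist_le => e e0; near=> y.
  rewrite distrC -cReN -cReD (le_trans (Re_le_cabs _))//; near: y; exact: h.
rewrite distrC -cImN -cImD (le_trans (Im_le_cabs _))//; near: y; exact: h.
Unshelve. all: by end_near. Qed.

Lemma cont_cst (c : R[i]) : cont (fun _ : T => c).
Proof. by split=> x; exact: cvg_cst. Qed.

Lemma contD f g : cont f -> cont g -> cont (fun x => f x + g x).
Proof.
move=> [fR fI] [gR gI]; split=> x.
  by under eq_fun do rewrite cReD; apply: cvgD; [exact: fR|exact: gR].
by under eq_fun do rewrite cImD; apply: cvgD; [exact: fI|exact: gI].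
Qed.

Lemma contM f g : cont f -> cont g -> cont (fun x => f x * g x).
Proof.
move=> [fR fI] [gR gI]; split=> x.
  under eq_fun do rewrite cReM.
  by apply: cvgB; apply: cvgM; [exact: fR|exact: gR|exact: fI|exact: gI].
under eq_fun do rewrite cImM.
by apply: cvgD; apply: cvgM; [exact: fR|exact: gI|exact: fI|exact: gR].
Qed.

Lemma contJ f : cont f -> cont (fun x => conjc (f x)).
Proof.
move=> [fR fI]; split=> x; first by under eq_fun do rewrite cReJ; exact: fR.
by under eq_fun do rewrite cImJ; apply: cvgN; exact: fI.
Qed.

Lemma contZ (c : R[i]) f : cont f -> cont (fun x => c * f x).
Proof. by move=> cf; apply: contM => //; exact: cont_cst. Qed.

Lemma contN f : cont f -> cont (fun x => - f x).
Proof.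
by move=> cf; under eq_fun do rewrite -mulN1r; exact: contZ.
Qed.

Lemma contB f g : cont f -> cont g -> cont (fun x => f x - g x).
Proof. by move=> cf cg; apply: contD => //; exact: contN. Qed.

Lemma cont_comp {S : topologicalType} (u : S -> T) f :
  continuous u -> cont f -> cont (fun x => f (u x)).
Proof.
by move=> cu [fR fI]; split=> x;
  (apply: (@continuous_comp _ _ _ u (fun x => _ (f x))); [exact: cu|]);
  [exact: fR|exact: fI].
Qed.

Lemma eq_cont f g : f =1 g -> cont f -> cont g.
Proof. by move=> /funext ->. Qed.

Lemma cont_sum (I : Type) (r : seq I) (P : pred I) (F : I -> T -> R[i]) :
  (forall i, P i -> cont (F i)) -> cont (fun x => \sum_(i <- r | P i) F i x).
Proof.
move=> h; elim: r => [|i r IH].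
  by apply: (eq_cont _ (cont_cst 0)) => x; rewrite big_nil.
case Pi : (P i); last by apply: (eq_cont _ IH) => x; rewrite big_cons Pi.
by apply: (eq_cont _ (contD (h _ Pi) IH)) => x; rewrite big_cons Pi.
Qed.

Lemma cont_real (u : T -> R) : continuous u -> cont (fun x => (u x)%:C%C).
Proof. by move=> cu; split => //= x; exact: cvg_cst. Qed.

Lemma cont_bounded f : compact [set: T] -> cont f ->
  exists c, forall x, cabs (f x) <= c.
Proof.
move=> cT /contP cf.
have /compact_near_coveringP/(_ R +oo (fun c x => cabs (f x) <= c)) := cT.
move=> /(_ _)[].
  move=> x _; exists ([set y | cabs (f y - f x) <= 1],
    [set c | 1 + cabs (f x) <= c]); first split.
  - exact: cf.
  - by apply: nbhs_pinfty_ge; rewrite num_real.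
  - move=> [y c] /= [h1 h2]; rewrite -(subrK (f x) (f y)).
    by rewrite (le_trans (cabsD _ _))// (le_trans _ h2)// lerD2r.
move=> c [_ hc]; exists (c + 1) => x; apply: hc => //.
by rewrite ltrDl.
Qed.

(** The limit is taken pointwise in the real and in the imaginary part, and
    the uniform Cauchy bound passes to it. *)
Lemma cont_uniform_lim (u : nat -> T -> R[i]) : (forall n, cont (u n)) ->
  (forall e : R, 0 < e -> exists N, forall m n x,
     (N <= m)%N -> (N <= n)%N -> cabs (u m x - u n x) <= e) ->
  exists2 v, cont v & forall e : R, 0 < e -> exists N, forall n x,
     (N <= n)%N -> cabs (u n x - v x) <= e.
Proof.
move=> cu uC.
have cvgx (h : R[i] -> R) x : (forall z w, h (z - w) = h z - h w) ->
    (forall z, `|h z| <= cabs z) -> cvgn (fun n => h (u n x)).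
  move=> hB hle; apply: cauchy_cvg; apply: cauchy_exP => e e0.
  have e2 : 0 < e / 2 by rewrite divr_gt0.
  have [N hN] := uC _ e2; exists (h (u N x)), N => // n /= Nn.
  rewrite -ball_normE /= -hB (le_lt_trans (hle _))//.
  rewrite (le_lt_trans (hN _ _ _ _ _))//.
  by rewrite ltr_pdivrMr// ltr_pMr// ltrDl.
pose v x := Complex (limn (fun n => complex.Re (u n x)))
                    (limn (fun n => complex.Im (u n x))).
have uv e : 0 < e -> exists N, forall n x, (N <= n)%N ->
    cabs (u n x - v x) <= e.
  move=> e0; have e2 : 0 < e / 2 by rewrite divr_gt0.
  have [N hN] := uC _ e2; exists N => n x Nn.
  have hR : cvgn (fun n => complex.Re (u n x)).
    by apply: cvgx => [z w|z]; rewrite ?cReD ?cReN ?Re_le_cabs.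
  have hI : cvgn (fun n => complex.Im (u n x)).
    by apply: cvgx => [z w|z]; rewrite ?cImD ?cImN ?Im_le_cabs.
  rewrite (le_trans (cabs_le_ReIm _))// [leRHS]splitr.
  rewrite cReD cImD cReN cImN lerD//=.
    have h : (fun m => `|complex.Re (u n x) - complex.Re (u m x)|) @ \oo -->
        `|complex.Re (u n x) - limn (fun n => complex.Re (u n x))|.
      by apply: cvg_norm; apply: cvgB => //; exact: cvg_cst.
    rewrite -(cvg_lim _ h)//; apply: limr_le.
      by apply/cvg_ex; eexists; exact: h.
    near=> m; rewrite -cReN -cReD (le_trans (Re_le_cabs _))// hN//.
    by near: m; exists N.
  have h : (fun m => `|complex.Im (u n x) - complex.Im (u m x)|) @ \oo -->
      `|complex.Im (u n x) - limn (fun n => complex.Im (u n x))|.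
    by apply: cvg_norm; apply: cvgB => //; exact: cvg_cst.
  rewrite -(cvg_lim _ h)//; apply: limr_le.
    by apply/cvg_ex; eexists; exact: h.
  near=> m; rewrite -cImN -cImD (le_trans (Im_le_cabs _))// hN//.
  by near: m; exists N.
exists v => //; apply/contP => x e e0.
have e3 : 0 < e / 3 by rewrite divr_gt0.
have [N hN] := uv _ e3.
have /contP/(_ x _ e3) hc := cu N.
near=> y.
have -> : v y - v x = (u N y - u N x) - (u N y - v y) + (u N x - v x) by ring.
have -> : e = e / 3 + e / 3 + e / 3 by field.
rewrite (le_trans (cabsD _ _))// lerD ?hN//.
rewrite (le_trans (cabsD _ _))// lerD ?cabsN ?hN//.
by near: y.
Unshelve. all: by end_near. Qed.

End continuous_complex_functions.

(** * Integration of bounded Borel functions *)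

Section integration.
Context {R : realType} {G : topologicalZmodType}.

Lemma continuous_borel_measurable (u : G -> R) : continuous u ->
  measurable_fun [set: borel G] (u : borel G -> R).
Proof.
move=> /continuousP cu; apply: (measurability _ (RGenOpens.measurableE R)).
move=> _ [_ [a [b ->]] <-]; rewrite setTI; apply: sub_sigma_algebra.
exact: cu.
Qed.

Lemma translation_continuous (a : G) : continuous (fun x => a + x).
Proof.
move=> x; apply: (@continuous_comp _ _ _ (fun x => (a, x))
  (fun x : G * G => x.1 + x.2)); last exact: add_continuous.
by apply: cvg_pair => /=; [exact: cvg_cst|exact: cvg_id].
Qed.

Lemma translation_measurable (a : G) :
  measurable_fun [set: borel G] (fun x : borel G => (a + x : borel G)).
Proof.
apply: (@measurability _ _ (borel G) (borel G) setT _
  (@open G : set (set (borel G)))) => //.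
move=> _ [B oB <-]; rewrite setTI; apply: sub_sigma_algebra.
have /continuousP h := @translation_continuous a.
exact: (h B oB).
Qed.

Variable mu : probability (borel G) R.

Local Notation I := (cintegral mu).
Implicit Types f g : G -> R[i].

(** Bounded Borel functions: a class that contains the continuous functions
    and the indicators, is an algebra, and on which integration is total. *)
Definition bm f : Prop :=
  [/\ measurable_fun [set: borel G] (fun x => complex.Re (f x)),
      measurable_fun [set: borel G] (fun x => complex.Im (f x)) &
      exists c, forall x, cabs (f x) <= c].

Lemma bounded_integrable (u : borel G -> R) (c : R) :
  measurable_fun [set: borel G] u -> (forall x, `|u x| <= c) ->
  mu.-integrable setT (EFin \o u).
Proof.
move=> mu_ hc; apply: measurable_bounded_integrable => //.
  by rewrite [X in (X < _)%E]probability_setT ltry.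
exists c; split; rewrite ?num_real// => d cd x _ /=.
by rewrite (le_trans (hc x))// ltW.
Qed.

Lemma bm_integrable f : bm f -> cintegrable mu f.
Proof.
move=> [mR mI [c hc]]; split; apply: (bounded_integrable (c := c)) => // x.
  by rewrite (le_trans (Re_le_cabs _)).
by rewrite (le_trans (Im_le_cabs _)).
Qed.

Lemma eq_bm f g : f =1 g -> bm f -> bm g.
Proof. by move=> /funext ->. Qed.

Lemma bm_cst c : bm (fun=> c).
Proof. by split; try exact: measurable_cst; exists (cabs c). Qed.

Lemma bmD f g : bm f -> bm g -> bm (fun x => f x + g x).
Proof.
move=> [fR fI [c hc]] [gR gI [d hd]]; split; last first.
- by exists (c + d) => x; rewrite (le_trans (cabsD _ _))// lerD.
- by under eq_fun do rewrite cImD; exact: measurable_funD.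
- by under eq_fun do rewrite cReD; exact: measurable_funD.
Qed.

Lemma bmM f g : bm f -> bm g -> bm (fun x => f x * g x).
Proof.
move=> [fR fI [c hc]] [gR gI [d hd]]; split; last first.
- exists (c * d) => x; rewrite cabsM ler_pM ?cabs_ge0//.
- by under eq_fun do rewrite cImM; apply: measurable_funD;
    exact: measurable_funM.
- by under eq_fun do rewrite cReM; apply: measurable_funB;
    exact: measurable_funM.
Qed.

Lemma bmJ f : bm f -> bm (fun x => conjc (f x)).
Proof.
move=> [fR fI [c hc]]; split.
- by under eq_fun do rewrite cReJ.
- under eq_fun do rewrite cImJ; exact: measurableT_comp.
- by exists c => x; rewrite cabsJ.
Qed.

Lemma bmZ c f : bm f -> bm (fun x => c * f x).
Proof. by move=> h; apply: bmM => //; exact: bm_cst. Qed.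

Lemma bmN f : bm f -> bm (fun x => - f x).
Proof. by move=> /(bmZ (-1)); apply: eq_bm => x; rewrite mulN1r. Qed.

Lemma bmB f g : bm f -> bm g -> bm (fun x => f x - g x).
Proof. by move=> bf bg; apply: bmD => //; exact: bmN. Qed.

Lemma bm_sum (J : Type) (r : seq J) (P : pred J) (F : J -> G -> R[i]) :
  (forall i, P i -> bm (F i)) -> bm (fun x => \sum_(i <- r | P i) F i x).
Proof.
move=> h; elim: r => [|i r IH].
  by apply: (eq_bm _ (bm_cst 0)) => x; rewrite big_nil.
case Pi : (P i); last by apply: (eq_bm _ IH) => x; rewrite big_cons Pi.
by apply: (eq_bm _ (bmD (h _ Pi) IH)) => x; rewrite big_cons Pi.
Qed.

Lemma bm_indic (A : set G) : measurable (A : set (borel G)) ->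
  bm (fun x => (\1_A x : R)%:C%C).
Proof.
move=> mA; split => /=; [exact: measurable_indic|exact: measurable_cst|].
exists 1 => x; rewrite cabs_real indicE; case: (_ \in _); rewrite ?normr1//.
by rewrite normr0.
Qed.

Lemma bm_translate f a : bm f -> bm (fun x => f (a + x)).
Proof.
move=> [fR fI [c hc]]; split.
- exact: (measurableT_comp fR (translation_measurable a)).
- exact: (measurableT_comp fI (translation_measurable a)).
- by exists c.
Qed.

Lemma cont_bm f : compact [set: G] -> cont f -> bm f.
Proof.
move=> cG cf; split; try exact: cont_bounded.
  by apply: continuous_borel_measurable; case: cf.
by apply: continuous_borel_measurable; case: cf.
Qed.

Lemma eq_int f g : f =1 g -> I f = I g.
Proof. by move=> /funext ->. Qed.

Lemma intD f g : bm f -> bm g -> I (fun x => f x + g x) = I f + I g.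
Proof.
move=> /bm_integrable[fR fI] /bm_integrable[gR gI].
apply: eqcP; rewrite ?cReD ?cImD /=.
  under [LHS]eq_Rintegral do rewrite cReD.
  exact: RintegralD.
under [LHS]eq_Rintegral do rewrite cImD.
exact: RintegralD.
Qed.

Lemma intZ c f : bm f -> I (fun x => c * f x) = c * I f.
Proof.
move=> /bm_integrable[fR fI].
have intZR (r : R) (u : borel G -> R) : mu.-integrable setT (EFin \o u) ->
    mu.-integrable setT (EFin \o (fun x => r * u x)).
  by move=> h; exact: (integrableZl measurableT r h).
apply: eqcP; rewrite ?cReM ?cImM /=.
  under [LHS]eq_Rintegral do rewrite cReM.
  rewrite RintegralB//; try exact: intZR.
  by rewrite !RintegralZl.
under [LHS]eq_Rintegral do rewrite cImM.
rewrite RintegralD//; try exact: intZR.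
by rewrite !RintegralZl.
Qed.

Lemma intZr c f : bm f -> I (fun x => f x * c) = I f * c.
Proof.
by move=> bf; rewrite mulrC -intZ//; apply: eq_int => x; rewrite mulrC.
Qed.

Lemma intN f : bm f -> I (fun x => - f x) = - I f.
Proof.
by move=> bf; rewrite -mulN1r -intZ//; apply: eq_int => x; rewrite mulN1r.
Qed.

Lemma intB f g : bm f -> bm g -> I (fun x => f x - g x) = I f - I g.
Proof. by move=> bf bg; rewrite intD ?intN//; exact: bmN. Qed.

Lemma int_cst c : I (fun=> c) = c.
Proof.
apply: eqcP => /=.
  by rewrite Rintegral_cst// [X in fine X]probability_setT mulr1.
by rewrite Rintegral_cst// [X in fine X]probability_setT mulr1.
Qed.

Lemma intJ f : bm f -> I (fun x => conjc (f x)) = conjc (I f).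
Proof.
move=> /bm_integrable[fR fI]; apply: eqcP; rewrite ?cReJ ?cImJ /=.
  by apply: eq_Rintegral => x _; rewrite cReJ.
rewrite -[RHS]mulN1r -RintegralZl//.
by apply: eq_Rintegral => x _; rewrite cImJ mulN1r.
Qed.

Lemma int_sum (J : Type) (r : seq J) (P : pred J) (F : J -> G -> R[i]) :
  (forall i, P i -> bm (F i)) ->
  I (fun x => \sum_(i <- r | P i) F i x) = \sum_(i <- r | P i) I (F i).
Proof.
move=> h; elim: r => [|i r IH].
  by rewrite big_nil -[RHS]int_cst; apply: eq_int => x; rewrite big_nil.
rewrite big_cons; case Pi : (P i); last first.
  by rewrite -IH; apply: eq_int => x; rewrite big_cons Pi.
rewrite -IH -intD; [|exact: h|exact: bm_sum].
by apply: eq_int => x; rewrite big_cons Pi.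
Qed.

(** The triangle inequality, reduced to monotonicity of the real integral by
    rotating the value of the integral onto the positive axis. *)
Lemma int_le f (u : G -> R) : bm f -> bm (fun x => (u x)%:C%C) ->
  (forall x, cabs (f x) <= u x) ->
  cabs (I f) <= complex.Re (I (fun x => (u x)%:C%C)).
Proof.
move=> bf bu fu.
have [->|n0] := eqVneq (I f) 0.
  rewrite cabs0 /=; apply: Rintegral_ge0 => x _.
  by rewrite (le_trans _ (fu x))// cabs_ge0.
pose w := conjc (I f) / (cabs (I f))%:C%C.
have cn0 : (cabs (I f))%:C%C != 0 :> R[i].
  by rewrite eq_complex /= eqxx andbT cabs_eq0.
have w1 : cabs w = 1.
  rewrite /w cabsM cabsV cabs_real cabsJ ger0_norm ?cabs_ge0// divff//.
  by rewrite cabs_eq0.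
have -> : cabs (I f) = complex.Re (I (fun x => w * f x)).
  have wI : w * I f = (cabs (I f))%:C%C.
    by rewrite /w mulrAC [conjc _ * _]mulrC mulcJ expr2 rmorphM /= mulfK.
  by rewrite intZ// wI.
have bwf : bm (fun x => w * f x) by exact: bmZ.
apply: le_Rintegral => //.
- by case/bm_integrable : bwf.
- by case/bm_integrable : bu.
move=> x _; rewrite (le_trans (ler_norm _))// (le_trans (Re_le_cabs _))//.
by rewrite cabsM w1 mul1r.
Qed.

Lemma int_le_cst f c : bm f -> (forall x, cabs (f x) <= c) -> cabs (I f) <= c.
Proof.
move=> bf h; have /= := int_le bf (bm_cst c%:C%C) h.
by rewrite Rintegral_cst// [X in fine X]probability_setT mulr1.
Qed.

Hypothesis haar : is_haar mu.

Lemma int_translate f a : bm f -> I (fun x => f (a + x)) = I f.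
Proof.
move=> bf.
have key (u : borel G -> R) : measurable_fun [set: borel G] u ->
    mu.-integrable setT (EFin \o (fun x => u (a + x))) ->
    (\int[mu]_(x in setT) u (a + x))%R = (\int[mu]_(x in setT) u x)%R.
  move=> mu_ iu; congr fine.
  have mT := translation_measurable a.
  have := integral_pushforward mT (mu := mu) (D := setT) (f := EFin \o u).
  rewrite preimage_setT => /(_ _ iu measurableT) <- //; last first.
    exact/measurable_EFinP.
  apply: eq_measure_integral => A mA _.
  rewrite /= /pushforward -[RHS](haar_invariant haar (- a)) //.
  congr (mu _); apply/seteqP; split=> [x /= Ax|x [y /= Ay <-]]; last first.
    by rewrite addNKr.
  exists (a + x); rewrite ?addKr//.
apply: eqcP => /=.
  apply: (key (fun x => complex.Re (f x))); first by case: bf.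
  by have [+ _] := bm_integrable (bm_translate a bf).
apply: (key (fun x => complex.Im (f x))); first by case: bf.
by have [_ +] := bm_integrable (bm_translate a bf).
Qed.

End integration.

(** * Fubini's theorem for continuous kernels on a compact group *)

Section compact_groups.
Context {R : realType} {G : topologicalZmodType}.
Hypothesis cG : compact [set: G].

(** Compactness is used in its filter form, along the filter generated by the
    finite sequences of points ordered by inclusion. *)
Lemma finite_nbhs_cover (U : G -> set G) : (forall y, nbhs y (U y)) ->
  exists s : seq G, forall x, exists2 y, y \in s & (U y)^° x.
Proof.
move=> nU; pose F := filter_from [set: seq G]
  (fun s0 => [set s : seq G | {subset s0 <= s}]).
have FF : Filter F.
  apply: filter_from_filter; first by exists [::].
  move=> s t _ _; exists (s ++ t) => // u /= h.
  by split=> x xs; apply: h; rewrite mem_cat xs ?orbT.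
have /compact_near_coveringP/(_ _ F
  (fun s x => exists2 y, y \in s & (U y)^° x) FF)[x _|s _ hs] := cG.
  exists ((U x)^°, [set s : seq G | {subset [:: x] <= s}]); first split => /=.
  - by apply: open_nbhs_nbhs; split; [exact: open_interior|exact: nU].
  - by exists [:: x].
  - by move=> [y s] [/= Uy xs]; exists x => //; apply: xs; rewrite mem_head.
by exists s => x; exact: hs.
Qed.

(** The tube lemma: compactness in the first variable makes the continuity in
    the second one uniform. *)
Lemma cont_section_uniform (H : G * G -> R[i]) (e : R) (y0 : G) : cont H ->
  0 < e -> \forall y \near y0, forall x, cabs (H (x, y) - H (x, y0)) <= e.
Proof.
move=> /contP cH e0.
have e2 : 0 < e / 2 by rewrite divr_gt0.
have /compact_near_coveringP hcov := cG.
suff : \forall y \near y0,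
    setT `<=` (fun x => cabs (H (x, y) - H (x, y0)) <= e).
  by apply: filterS => y hy x; exact: hy.
apply: (hcov G (nbhs y0) (fun y x => cabs (H (x, y) - H (x, y0)) <= e)) => x _.
have [[A B] /= [nA nB] AB] := cH (x, y0) _ e2.
exists (A, B) => // -[x' y] [/= Ax By].
have -> : H (x', y) - H (x', y0) =
  (H (x', y) - H (x, y0)) - (H (x', y0) - H (x, y0)) by ring.
rewrite (le_trans (cabsD _ _))// [leRHS]splitr cabsN lerD//.
  by apply: (AB (x', y)).
by apply: (AB (x', y0)); split => //=; exact: nbhs_singleton.
Qed.

Variable mu : probability (borel G) R.
Local Notation I := (cintegral mu).
Local Notation bm := (@bm R G).
Implicit Types f g h : G -> R[i].

Let cbm f : cont f -> bm f.
Proof. exact: cont_bm. Qed.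

Lemma cont_section1 (H : G * G -> R[i]) x : cont H -> cont (fun y => H (x, y)).
Proof.
apply: cont_comp => y; apply: (@cvg_pair _ _ _ _ (nbhs x) (nbhs y)) => /=.
  exact: cvg_cst.
exact: cvg_id.
Qed.

Lemma cont_section2 (H : G * G -> R[i]) y : cont H -> cont (fun x => H (x, y)).
Proof.
apply: cont_comp => x; apply: (@cvg_pair _ _ _ _ (nbhs x) (nbhs y)) => /=.
  exact: cvg_id.
exact: cvg_cst.
Qed.

Lemma swap_continuous : continuous (fun p : G * G => (p.2, p.1)).
Proof.
move=> p; apply: (@cvg_pair _ _ _ _ (nbhs p.2) (nbhs p.1)) => /=.
  exact: cvg_snd.
exact: cvg_fst.
Qed.

Lemma cont_int (H : G * G -> R[i]) h : cont H -> bm h ->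
  cont (fun x => I (fun y => H (x, y) * h y)).
Proof.
move=> cH bh; have [_ _ [c hc]] := bh.
have c0 : 0 <= c by rewrite (le_trans (cabs_ge0 _) (hc 0)).
apply/contP => x0 e e0.
have e1 : 0 < e / (c + 1) by rewrite divr_gt0// ltr_wpDl.
have := cont_section_uniform x0 (cont_comp swap_continuous cH) e1.
apply: filterS => x hx /=.
rewrite -intB; [|by apply: bmM => //; apply: cbm; exact: cont_section1..].
apply: int_le_cst => [|y].
  by apply: bmB; apply: bmM => //; apply: cbm; exact: cont_section1.
rewrite -mulrBl cabsM.
have -> : e = e / (c + 1) * (c + 1) by rewrite divfK// gt_eqF// ltr_wpDl.
apply: ler_pM; rewrite ?cabs_ge0//; first exact: hx.
by rewrite (le_trans (hc y))// lerDl.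
Qed.

(** The pieces are a finite cover by the neighbourhoods of the tube lemma, made
    disjoint.  Approximation by sums of products gives Fubini's theorem without
    reference to a sigma-algebra on G * G, where the product of the Borel
    sigma-algebras may be smaller than the Borel sigma-algebra. *)
Lemma kernel_step_approx (H : G * G -> R[i]) (e : R) : cont H -> 0 < e ->
  exists (n : nat) (B : nat -> set G) (p : nat -> G),
    (forall i, measurable (B i : set (borel G))) /\
    forall x y, cabs (H (x, y) -
      \sum_(i < n) H (x, p i) * (\1_(B i) y : R)%:C%C) <= e.
Proof.
move=> cH e0.
pose U (y0 : G) := [set y | forall x, cabs (H (x, y) - H (x, y0)) <= e].
have [s hs] : exists s : seq G, forall x, exists2 y, y \in s & (U y)^° x.
  by apply: finite_nbhs_cover => y; exact: cont_section_uniform.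
pose p (i : nat) := nth 0 s i.
pose V (i : nat) := if (i < size s)%N then (U (p i))^° else set0.
exists (size s), (seqDU V), p; split.
  apply: (@seqDU_measurable _ (borel G)) => i; rewrite /V; case: ifP => // _.
  by apply: sub_sigma_algebra; exact: open_interior.
move=> x y.
have : (\bigcup_k V k) y.
  have [z zs Uz] := hs y; exists (index z s) => //.
  by rewrite /V index_mem zs /p nth_index.
rewrite seqDU_bigcup_eq => -[i _ Vi].
have is_ : (i < size s)%N.
  by have := subset_seqDU Vi; rewrite /V; case: ifP.
rewrite (bigD1 (Ordinal is_))//= big1 ?addr0 => [|j ji].
  rewrite indicE mem_set//= mulr1.
  by have := subset_seqDU Vi; rewrite /V is_ => /interior_subset; exact.
rewrite indicE memNset ?mulr0// => Vj; move: ji => /eqP; apply.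
apply: val_inj => /=; apply: (@trivIset_seqDU _ V) => //.
by exists y.
Qed.

(** Both iterated integrals agree on the step kernels, by linearity, and both
    are continuous in the kernel for the sup norm. *)
Lemma fubini_cont (H : G * G -> R[i]) h : cont H -> bm h ->
  I (fun x => I (fun y => H (x, y) * h y)) =
  I (fun y => I (fun x => H (x, y)) * h y).
Proof.
move=> cH bh; have [_ _ [c hc]] := bh.
have c0 : 0 <= c by rewrite (le_trans (cabs_ge0 _) (hc 0)).
apply/eqP; rewrite -subr_eq0; apply/eqP; apply: cabs_le_eq0 => e e0.
have e1 : 0 < e / (2 * (c + 1)) by rewrite divr_gt0// mulr_gt0// ltr_wpDl.
have [n [B [p [mB hB]]]] := kernel_step_approx cH e1.
set d := e / _ in e1 hB.
have dc : d * c <= e / 2.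
  have -> : e / 2 = d * (c + 1) by rewrite /d; field; rewrite gt_eqF// ltr_wpDl.
  by rewrite ler_wpM2l ?ltW// ltrDl.
pose H' x y := \sum_(i < n) H (x, p i) * (\1_(B i) y : R)%:C%C.
have bB i : bm (fun y => (\1_(B i) y : R)%:C%C) by exact: bm_indic.
have bHi x : bm (fun y => H' x y).
  by apply: bm_sum => i _; apply: bmZ.
have bHh x : bm (fun y => H' x y * h y) by exact: bmM.
have bH1 x : bm (fun y => H (x, y)) by apply: cbm; exact: cont_section1.
have bH2 y : bm (fun x => H (x, y)) by apply: cbm; exact: cont_section2.
have bH'2 y : bm (fun x => H' x y).
  by apply: bm_sum => i _; apply: bmM => //; exact: bm_cst.
pose a i := I (fun y => (\1_(B i) y : R)%:C%C * h y).
have E1 x : I (fun y => H' x y * h y) = \sum_(i < n) H (x, p i) * a i.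
  rewrite (@eq_int _ _ _ _ (fun y => \sum_(i < n) H (x, p i) *
    ((\1_(B i) y : R)%:C%C * h y))); last first.
    by move=> y; rewrite mulr_suml; apply: eq_bigr => i _; rewrite mulrA.
  rewrite int_sum => [|i _]; last by apply: bmZ; exact: bmM.
  by apply: eq_bigr => i _; rewrite intZ//; exact: bmM.
have E2 y : I (fun x => H' x y) =
    \sum_(i < n) I (fun x => H (x, p i)) * (\1_(B i) y : R)%:C%C.
  rewrite int_sum => [|i _]; last by apply: bmM => //; exact: bm_cst.
  by apply: eq_bigr => i _; rewrite intZr.
have bE1 : bm (fun x => I (fun y => H' x y * h y)).
  apply: (@eq_bm _ _ (fun x => \sum_(i < n) H (x, p i) * a i)) => [x|].
    by rewrite E1.
  by apply: bm_sum => i _; apply: bmM => //; exact: bm_cst.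
have bE2 : bm (fun y => I (fun x => H' x y)).
  apply: (@eq_bm _ _ (fun y => \sum_(i < n) I (fun x => H (x, p i)) *
    (\1_(B i) y : R)%:C%C)) => [y|]; first by rewrite E2.
  by apply: bm_sum => i _; exact: bmZ.
have bI1 : bm (fun x => I (fun y => H (x, y) * h y)).
  by apply: cbm; exact: cont_int.
have bI2 : bm (fun y => I (fun x => H (x, y))).
  apply: cbm; apply: (@eq_cont _ _ (fun y => I (fun x => H (x, y) * 1))).
    by move=> y; apply: eq_int => x; rewrite mulr1.
  exact: (cont_int (cont_comp swap_continuous cH) (bm_cst 1)).
have E : I (fun x => I (fun y => H' x y * h y)) =
         I (fun y => I (fun x => H' x y) * h y).
  under eq_int do rewrite E1.
  rewrite int_sum => [|i _]; last by apply: bmM => //; exact: bm_cst.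
  under [RHS]eq_int do rewrite E2 mulr_suml.
  rewrite int_sum => [|i _]; last by apply: bmM => //; exact: bmZ.
  apply: eq_bigr => i _; rewrite intZr// -intZ; last exact: bmM.
  by apply: eq_int => y; rewrite mulrA.
set X := I _; set Y := I _.
have -> : X - Y = (X - I (fun x => I (fun y => H' x y * h y))) -
    (Y - I (fun y => I (fun x => H' x y) * h y)) by rewrite E; ring.
rewrite (le_trans (cabsD _ _))// [leRHS]splitr cabsN lerD//.
  rewrite -intB//; apply: int_le_cst => [|x]; first exact: bmB.
  rewrite -intB//; [|exact: bmM].
  apply: int_le_cst => [|y]; first by apply: bmB => //; exact: bmM.
  rewrite -mulrBl cabsM (le_trans _ dc)// ler_pM ?cabs_ge0 ?hB//.
rewrite -intB//; [|exact: bmM..].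
apply: int_le_cst => [|y]; first by apply: bmB; exact: bmM.
rewrite -mulrBl cabsM (le_trans _ dc)// ler_pM ?cabs_ge0 ?hB//.
rewrite -intB//; apply: int_le_cst => [|x]; first exact: bmB.
exact: hB.
Qed.

End compact_groups.

(** * Haar measure on a compact group *)

Section haar_integral.
Context {R : realType} {G : topologicalZmodType}.
Variable mu : probability (borel G) R.
Hypotheses (cG : compact [set: G]) (haar : is_haar mu).
Local Notation I := (cintegral mu).
Local Notation bm := (@bm R G).
Implicit Types f g h : G -> R[i].

Let cbm f : cont f -> bm f.
Proof. exact: cont_bm. Qed.

Lemma cont_translate f a : cont f -> cont (fun x => f (a + x)).
Proof. by apply: cont_comp; exact: translation_continuous. Qed.

Lemma cont_opp f : cont f -> cont (fun x => f (- x)).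
Proof. by apply: cont_comp; exact: opp_continuous. Qed.

Lemma cont_sub f : cont f -> cont (fun p : G * G => f (p.1 - p.2)).
Proof. by apply: cont_comp; exact: sub_continuous. Qed.

(** Averaging f (x - y) over both variables in the two possible orders
    compares the integral of f with that of its reflection. *)
Lemma int_opp f : cont f -> I (fun x => f (- x)) = I f.
Proof.
move=> cf.
have := fubini_cont cG mu (cont_sub cf) (bm_cst (R := R) (G := G) 1).
under eq_int do under eq_int do rewrite mulr1 /=.
under [X in _ = X -> _]eq_int do rewrite mulr1 /=.
have -> : (fun x => I (fun y => f (x - y))) = fun=> I (fun y => f (- y)).
  apply/funext => x.
  rewrite -(int_translate haar x (f := fun y => f (x - y))); last first.
    by apply: cbm; apply: (cont_opp (cont_translate x cf)).
  by apply: eq_int => y; rewrite opprD addrA subrr sub0r.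
have -> : (fun y => I (fun x => f (x - y))) = fun=> I f.
  apply/funext => y.
  rewrite -[RHS](int_translate haar (- y)); last exact: cbm.
  by apply: eq_int => x; rewrite addrC.
by rewrite !int_cst.
Qed.

(** Finitely many translates of a nonempty open set cover the group, so that
    it has positive measure. *)
Lemma int_normsq_eq0 f : cont f ->
  I (fun x => (cabs (f x) ^+ 2)%:C%C) = 0 -> forall x, f x = 0.
Proof.
move=> cf If0 x0; apply/eqP; apply: contraPT If0 => fx0.
pose u x := cabs (f x) ^+ 2.
have cu : cont (fun x => (u x)%:C%C).
  apply: (@eq_cont _ _ (fun x => f x * conjc (f x))) => [x|].
    by rewrite mulcJ.
  by apply: contM => //; exact: contJ.
have u0 x : 0 <= u x by rewrite sqr_ge0.
have ux0 : 0 < u x0.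
  by rewrite exprn_gt0// lt_neqAle eq_sym cabs_eq0 fx0 cabs_ge0.
pose U (y : G) := [set x | u x0 / 2 < u (x0 - y + x)].
have [s hs] : exists s : seq G, forall x, exists2 y, y \in s & (U y)^° x.
  apply: finite_nbhs_cover => // y.
  have [+ _] := cont_translate (x0 - y) cu.
  move=> /(_ y)/=; rewrite /continuous_at subrK => h.
  apply: (h [set r | u x0 / 2 < r]).
  apply: open_nbhs_nbhs; split; first exact: open_gt.
  by rewrite /= ltr_pdivrMr// ltr_pMr// ltrDl.
pose v x := \sum_(y <- s) (u (x0 - y + x))%:C%C.
have bv y : bm (fun x => (u (x0 - y + x))%:C%C).
  by apply: cbm; exact: (cont_translate (x0 - y) cu).
move=> Iu0.
have Iv : I v = 0.
  rewrite int_sum// big1// => y _.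
  by rewrite (int_translate haar (x0 - y) (cbm cu)).
have : u x0 / 2 <= complex.Re (I v).
  have vE : v = fun x => (\sum_(y <- s) u (x0 - y + x))%:C%C.
    by apply/funext => x; rewrite rmorph_sum.
  have -> : u x0 / 2 = cabs (I (fun=> (u x0 / 2)%:C%C)).
    by rewrite int_cst cabs_real ger0_norm// divr_ge0.
  rewrite vE; apply: int_le; first exact: bm_cst.
    by rewrite -vE; apply: bm_sum => y _; exact: bv.
  move=> x; rewrite cabs_real ger0_norm ?divr_ge0//.
  have [y ys /interior_subset/= /ltW/le_trans] := hs x; apply.
  rewrite (big_rem y)//= lerDl sumr_ge0// => *; exact: u0.
by rewrite Iv /= leNgt divr_gt0.
Qed.

Lemma int_indic (A : set G) : measurable (A : set (borel G)) ->
  I (fun x => (\1_A x : R)%:C%C) = (fine (mu A))%:C%C.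
Proof.
move=> mA; apply: eqcP => /=; last by rewrite Rintegral_cst// mul0r.
by rewrite /Rintegral integral_indic// setIT.
Qed.

Hypothesis hG : hausdorff_space G.

(** Outer regularity of a set and of its complement squeezes the set between a
    compact and an open set of almost the same measure; Urysohn's lemma puts a
    continuous function between their indicators. *)
Lemma int_cont_eq0 h : bm h ->
  (forall f, cont f -> I (fun x => f x * h x) = 0) ->
  forall E : set G, measurable (E : set (borel G)) ->
    I (fun x => (\1_E x : R)%:C%C * h x) = 0.
Proof.
move=> bh h0 E mE; have [_ _ [c hc]] := bh.
have c0 : 0 <= c by rewrite (le_trans (cabs_ge0 _) (hc 0)).
apply: cabs_le_eq0 => e e0.
have e1 : 0 < e / (2 * (c + 1)) by rewrite divr_gt0// mulr_gt0// ltr_wpDl.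
set d := e / _ in e1.
have dc : c * (d + d) <= e.
  have -> : e = (c + 1) * (d + d).
    by rewrite /d; field; rewrite gt_eqF// ltr_wpDl.
  by rewrite ler_wpM2r ?lerDl// addr_ge0// ltW.
have outer (A : set G) : measurable (A : set (borel G)) ->
    exists U : set G, [/\ open U, A `<=` U &
      fine (mu U) <= fine (mu A) + d].
  move=> mA; have := haar_outer_regular haar mA.
  set S := [set _ | _ in _] => muA.
  have fA : mu A \is a fin_num by rewrite fin_num_measure.
  have := @lb_ereal_inf_adherent _ S _ e1; rewrite -muA => /(_ fA).
  move=> [_ [U [oU AU] <-] lU]; exists U; split => //.
  rewrite -lee_fin EFinD !fineK ?ltW// fin_num_measure//.
  exact: sub_sigma_algebra.
have [U [oU EU mU]] := outer E mE.
have [V [oV EV mV]] := outer (~` E) (measurableC mE).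
have mUo : measurable (U : set (borel G)) by exact: sub_sigma_algebra.
have mVo : measurable (V : set (borel G)) by exact: sub_sigma_algebra.
have muC : fine (mu (~` E)) = 1 - fine (mu E).
  rewrite probability_setC// -(fineK (x := mu E)) ?fin_num_measure//.
have UV x : U x \/ V x.
  by have [Ex|nEx] := pselect (E x); [left; exact: EU|right; exact: EV].
have /normal_separatorP sep := compact_normal hG cG.
have /(@uniform_separatorP _ R)[phi [cphi phi01 phi0 phi1]] :
    uniform_separator (~` U) (~` V).
  apply: (sep R); [exact: open_closedC|exact: open_closedC|].
  by rewrite -subset0 => x [nU nV]; have [] := UV x.
have cp : cont (fun x => (phi x)%:C%C : R[i]) by exact: cont_real.
(* As U and V cover the group, this is c times the indicator of their
   intersection, which is where phi may differ from the indicator of E. *)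
pose u x := c * (\1_U x + \1_V x - 1) : R.
have bu : bm (fun x => (u x)%:C%C).
  apply: (@eq_bm _ _ (fun x => c%:C%C *
    ((\1_U x : R)%:C%C + (\1_V x : R)%:C%C - 1%:C%C))).
    by move=> x; rewrite -rmorphD -rmorphB -rmorphM.
  by apply: bmZ; apply: bmB; [apply: bmD; exact: bm_indic|exact: bm_cst].
have bE : bm (fun x => (\1_E x : R)%:C%C) by exact: bm_indic.
rewrite -[X in cabs X]subr0 -(h0 _ cp) -intB; [|apply: bmM => //; exact: cbm..].
apply: (@le_trans _ _ (complex.Re (I (fun x => (u x)%:C%C)))).
  apply: int_le => //; first by apply: bmB; apply: bmM => //; exact: cbm.
  move=> x; rewrite -mulrBl cabsM mulrC ler_pM ?cabs_ge0//.
  rewrite -rmorphB /= cabs_real.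
  have [phix0 phix1] : 0 <= phi x /\ phi x <= 1.
    have /phi01 : range phi (phi x) by exists x.
    by rewrite /= in_itv /= => /andP[].
  have nU : ~ U x -> phi x = 0 by move=> nUx; apply: phi0; exists x.
  have nV : ~ V x -> phi x = 1 by move=> nVx; apply: phi1; exists x.
  rewrite !indicE.
  have [Ux|nUx] := pselect (U x); have [Vx|nVx] := pselect (V x).
  - rewrite (mem_set Ux) (mem_set Vx) /= mulr1n addrK ler_norml.
    by case: (x \in E) => /=; lra.
  - have Ex : E x by apply: contrapT => nEx; apply: nVx; exact: EV.
    rewrite (mem_set Ex) (mem_set Ux) (memNset nVx) nV//= subrr normr0.
    by rewrite addr0 subrr.
  - have nEx : ~ E x by move=> Ex; apply: nUx; exact: EU.
    rewrite (memNset nEx) (mem_set Vx) (memNset nUx) nU//= subrr normr0.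
    by rewrite add0r subrr.
  - by have [] := UV x.
rewrite (@eq_int _ _ _ _ (fun x => c%:C%C *
    ((\1_U x : R)%:C%C + (\1_V x : R)%:C%C - 1%:C%C))); last first.
  by move=> x; rewrite -rmorphD -rmorphB -rmorphM.
rewrite intZ; last by apply: bmB; [apply: bmD; exact: bm_indic|exact: bm_cst].
rewrite intB; [|by apply: bmD; exact: bm_indic|exact: bm_cst].
rewrite intD; [|exact: bm_indic..]; rewrite !int_indic// int_cst.
rewrite -rmorphD -rmorphB -rmorphM /= (le_trans _ dc)// ler_wpM2l//.
by move: mU mV; rewrite muC; lra.
Qed.

Lemma cont_orthogonal_ae0 h : bm h ->
  (forall f, cont f -> I (fun x => f x * h x) = 0) ->
  {ae mu, forall x : borel G, h x = 0}.
Proof.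
move=> bh h0; have [iR iI] := bm_integrable mu bh.
have key (u : borel G -> R) : mu.-integrable setT (EFin \o u) ->
    (forall E : set (borel G), measurable E ->
      (\int[mu]_(x in setT) (\1_E x * u x))%R = 0) ->
    {ae mu, forall x, u x = 0}.
  move=> iu u0.
  have : ae_eq mu setT (EFin \o u) (cst 0%E).
    apply: integral_ae_eq => // E _ mE.
    rewrite integral_cst// mul0e -[LHS]fineK; last first.
      by apply: integrable_fin_num => //; exact: integrableS iu.
    transitivity ((\int[mu]_(x in setT) (\1_E x * u x))%R)%:E; last first.
      by rewrite u0.
    rewrite /Rintegral integral_mkcond; congr (fine _)%:E.
    apply: eq_integral => x _; rewrite patchE indicE /=.
    by case: (x \in E); rewrite ?mul1r ?mul0r.
  by apply: filterS => x /(_ Logic.I)[].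
have hR := key _ iR; have hI := key _ iI.
have E0 := int_cont_eq0 bh h0.
have {}hR : {ae mu, forall x, complex.Re (h x) = 0}.
  apply: hR => E mE; have /(congr1 (@complex.Re R))/= <- := E0 E mE.
  by apply: eq_Rintegral => x _; rewrite cReM /= mul0r subr0.
have {}hI : {ae mu, forall x, complex.Im (h x) = 0}.
  apply: hI => E mE; have /(congr1 (@complex.Im R))/= <- := E0 E mE.
  by apply: eq_Rintegral => x _; rewrite cImM /= mul0r addr0.
by near=> x; apply: eqcP; near: x.
Unshelve. all: by end_near. Qed.

End haar_integral.

(** * Convolution of continuous functions *)

(** Logarithmic convexity makes the ratios [b n.+1 / b n] increase to a limit
    lam; submultiplicativity bounds by [b n] a product of [n.+1] ratios of
    large index, and these tend to lam. *)
Lemma growth_rate {R : realType} (b : nat -> R) : (forall n, 0 < b n) ->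
  (forall n, b n.+1 ^+ 2 <= b n * b n.+2) ->
  (forall m n, b (m + n).+1 <= b m * b n) ->
  exists2 lam : R, 0 < lam &
    forall n, lam ^+ n.+1 <= b n /\ b n.+1 <= lam * b n.
Proof.
move=> b0 bconv bsub.
pose rho n := b n.+1 / b n.
have rho0 n : 0 < rho n by rewrite divr_gt0.
have rhoS n : rho n <= rho n.+1.
  by rewrite /rho ler_pdivrMr// mulrAC ler_pdivlMr// -expr2 mulrC.
have rho_nd : nondecreasing_seq rho by apply/nondecreasing_seqP.
have rho_ub : has_ubound (range rho).
  exists (b 0%N); apply/ubP => _ [n _ <-]; rewrite ler_pdivrMr// mulrC.
  by have := bsub n 0%N; rewrite addn0.
have rho_cvg := nondecreasing_cvgn rho_nd rho_ub.
set lam := sup (range rho) in rho_cvg.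
have rho_lam n : rho n <= lam by apply: ub_le_sup => //; exists n.
exists lam => [|n]; first exact: lt_le_trans (rho_lam 0%N).
split; last by rewrite -ler_pdivrMr//; exact: rho_lam.
have hm m : rho m ^+ n.+1 <= b n.
  have : b m * rho m ^+ n.+1 <= b (m + n).+1.
    elim: n => [|n IH]; first by rewrite expr1 addn0 /rho mulrC divfK// gt_eqF.
    rewrite exprSr mulrA addnS.
    have : b (m + n).+2 = b (m + n).+1 * rho (m + n).+1.
      by rewrite mulrC divfK// gt_eqF.
    move=> ->; apply: ler_pM => //; [|exact: ltW|].
      by apply: mulr_ge0; [exact: ltW|apply: exprn_ge0; exact: ltW].
    by apply: rho_nd; rewrite -addnS leq_addr.
  by move=> /le_trans/(_ (bsub m n)); rewrite ler_pM2l.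
have hl : rho m ^+ n.+1 @[m --> \oo] --> lam ^+ n.+1.
  exact: (cvg_comp _ _ rho_cvg (@exprn_continuous _ _ _)).
rewrite -(cvg_lim _ hl)//; apply: limr_le.
  by apply/cvg_ex; eexists; exact: hl.
by near=> m; exact: hm.
Unshelve. all: by end_near. Qed.

(** Convolution is locked so that the comparison of two of its values never
    unfolds to a comparison of integrals; the same holds for the squared L2 norm
    below. *)
HB.lock Definition conv {R : realType} {G : topologicalZmodType}
  (mu : probability (borel G) R) (f g : G -> R[i]) : G -> R[i] :=
  fun x => cintegral mu (fun y => f (x - y) * g y).

(** The squared L2 norm. *)
HB.lock Definition nsq {R : realType} {G : topologicalZmodType}
  (mu : probability (borel G) R) (f : G -> R[i]) : R :=
  complex.Re (cintegral mu (fun x => (cabs (f x) ^+ 2)%:C%C)).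

Section convolution.
Context {R : realType} {G : topologicalZmodType}.
Variable mu : probability (borel G) R.
Hypotheses (cG : compact [set: G]) (haar : is_haar mu).
Local Notation I := (cintegral mu).
Local Notation bm := (@bm R G).
Local Notation nsq := (nsq mu).
Local Notation conv := (conv mu).
Implicit Types f g h : G -> R[i].

Let cbm f : cont f -> bm f.
Proof. exact: cont_bm. Qed.

Lemma convE f g x : conv f g x = I (fun y => f (x - y) * g y).
Proof. by rewrite conv.unlock. Qed.

(** The involution of the convolution algebra. *)
Definition adj f : G -> R[i] := fun x => conjc (f (- x)).

Lemma cont_subl f x : cont f -> cont (fun y => f (x - y)).
Proof. by move=> cf; exact: (cont_opp (cont_translate x cf)). Qed.

Lemma bm_conv f g x : cont f -> bm g -> bm (fun y => f (x - y) * g y).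
Proof. by move=> cf bg; apply: bmM => //; apply: cbm; exact: cont_subl. Qed.

Lemma cont_conv f g : cont f -> bm g -> cont (conv f g).
Proof.
by move=> cf bg; rewrite conv.unlock; exact: (cont_int cG mu (cont_sub cf) bg).
Qed.

Lemma cont_adj f : cont f -> cont (adj f).
Proof. by move=> cf; apply: contJ; exact: cont_opp. Qed.

Lemma convC f g : cont f -> cont g -> conv f g = conv g f.
Proof.
move=> cf cg; apply/funext => x; rewrite !convE.
rewrite -(int_translate haar x); last by apply: bm_conv => //; exact: cbm.
rewrite -(int_opp cG haar) //; last first.
  apply: contM; last exact: cont_translate.
  by apply: (@cont_translate _ _ (fun y => f (x - y))); exact: cont_subl.
by apply: eq_int => y; rewrite opprB addrC subrK mulrC.
Qed.

Lemma convA f g h : cont f -> cont g -> bm h ->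
  conv f (conv g h) = conv (conv f g) h.
Proof.
move=> cf cg bh; apply/funext => x; rewrite !convE.
under eq_int do rewrite convE; under [RHS]eq_int do rewrite convE.
pose H (p : G * G) := f (x - p.1) * g (p.1 - p.2).
have cH : cont H.
  apply: contM; last exact: cont_sub.
  apply: (@cont_comp _ _ _ (fun p : G * G => p.1) (fun y => f (x - y))).
    by move=> p; exact: cvg_fst.
  exact: cont_subl.
have := fubini_cont cG mu cH bh; rewrite /H /= => E.
transitivity (I (fun y => I (fun z => f (x - y) * g (y - z) * h z))).
  apply: eq_int => y; rewrite -intZ; last exact: bm_conv.
  by apply: eq_int => z; rewrite mulrA.
rewrite E; apply: eq_int => z; congr (_ * _).
rewrite -(int_translate haar z (f := fun y => f (x - y) * g (y - z))).
  apply: eq_int => y; congr (f _ * g _); last by rewrite addrC addKr.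
  by rewrite opprD addrA.
apply: cbm; apply: contM; first exact: cont_subl.
by apply: (eq_cont _ (cont_translate (- z) cg)) => y; rewrite addrC.
Qed.

Lemma convDr f g h : cont f -> bm g -> bm h ->
  conv f (fun x => g x + h x) = (fun x => conv f g x + conv f h x).
Proof.
move=> cf bg bh; apply/funext => x; rewrite !convE -intD; [|exact: bm_conv..].
by apply: eq_int => y; rewrite mulrDr.
Qed.

Lemma convZr c f g : cont f -> bm g ->
  conv f (fun x => c * g x) = (fun x => c * conv f g x).
Proof.
move=> cf bg; apply/funext => x; rewrite !convE -intZ; last exact: bm_conv.
by apply: eq_int => y; rewrite mulrCA.
Qed.

Lemma convDl f g h : cont f -> cont g -> cont h ->
  conv (fun x => f x + g x) h = (fun x => conv f h x + conv g h x).
Proof.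
move=> cf cg ch; rewrite convC//; last exact: contD.
by rewrite convDr// ?(convC ch)//; exact: cbm.
Qed.

Lemma convZl c f g : cont f -> cont g ->
  conv (fun x => c * f x) g = (fun x => c * conv f g x).
Proof.
move=> cf cg; rewrite convC//; last exact: contZ.
by rewrite convZr// ?(convC cg)//; exact: cbm.
Qed.

Lemma adjK f : adj (adj f) = f.
Proof. by apply/funext => x; rewrite /adj opprK conjcK. Qed.

Lemma adj_conv f g : cont f -> cont g -> adj (conv f g) = conv (adj f) (adj g).
Proof.
move=> cf cg; apply/funext => x; rewrite /adj !convE -intJ; last first.
  by apply: bm_conv => //; exact: cbm.
rewrite -(int_opp cG haar); last first.
  by apply: contJ; apply: contM => //; exact: cont_subl.
by apply: eq_int => y; rewrite rmorphM /= opprK opprB addrC.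
Qed.

Lemma conv_translate a f g :
  conv (fun x => f (a + x)) g = (fun x => conv f g (a + x)).
Proof.
by apply/funext => x; rewrite !convE; apply: eq_int => y; rewrite addrA.
Qed.

Lemma nsqE f : I (fun x => conjc (f x) * f x) = (nsq f)%:C%C.
Proof.
apply: eqcP; rewrite ?nsq.unlock /=.
  by apply: eq_Rintegral => x _; rewrite mulrC mulcJ.
rewrite -[RHS](mul0r (fine (mu setT))) -Rintegral_cst//.
by apply: eq_Rintegral => x _; rewrite mulrC mulcJ.
Qed.

Lemma nsq_ge0 f : 0 <= nsq f.
Proof. by rewrite nsq.unlock; apply: Rintegral_ge0 => x _; rewrite sqr_ge0. Qed.

Lemma nsq_eq0 f : cont f -> nsq f = 0 -> forall x, f x = 0.
Proof.
move=> cf f0; apply: (int_normsq_eq0 cG haar cf).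
transitivity ((nsq f)%:C%C : R[i]); last by rewrite f0.
by rewrite -nsqE; apply: eq_int => x; rewrite mulrC mulcJ.
Qed.

Lemma nsq_gt0 f x : cont f -> f x != 0 -> 0 < nsq f.
Proof.
move=> cf; apply: contraNT; rewrite lt_neqAle nsq_ge0 andbT negbK eq_sym.
by move=> /eqP f0; apply/eqP; exact: nsq_eq0.
Qed.

Lemma conv_adj0 f : conv (adj f) f 0 = (nsq f)%:C%C.
Proof.
by rewrite -nsqE convE; apply: eq_int => x; rewrite /adj sub0r opprK.
Qed.

Lemma cauchy_schwarz f g : cont f -> cont g ->
  cabs (I (fun x => f x * g x)) ^+ 2 <= nsq f * nsq g.
Proof.
move=> cf cg; set z := I _.
have [g0|gn0] := eqVneq (nsq g) 0.
  rewrite /z (@eq_int _ _ _ _ (fun=> 0)) ?int_cst ?cabs0 ?expr0n/=.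
    by rewrite g0 mulr0.
  by move=> x; rewrite (nsq_eq0 cg g0) mulr0.
have g0 : 0 < nsq g by rewrite lt_neqAle eq_sym gn0 nsq_ge0.
(* The multiple of the conjugate of g that is closest to f in L2. *)
pose c := z / (nsq g)%:C%C.
have cf' := contJ cf; have cg' := contJ cg.
have key : nsq (fun x => f x - c * conjc (g x)) =
    nsq f - cabs z ^+ 2 / nsq g.
  apply: complexI; rewrite -nsqE.
  rewrite (@eq_int _ _ _ _ (fun x => (conjc (f x) * f x -
    conjc c * (f x * g x)) - (c * (conjc (f x * g x)) -
    (c * conjc c) * (conjc (g x) * g x)))); last first.
    by move=> x; rewrite rmorphB !rmorphM /= conjcK; ring.
  have b1 : bm (fun x => f x * g x) by apply: cbm; exact: contM.
  have b2 : bm (fun x => conjc (f x * g x)) by exact: bmJ.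
  have b3 : bm (fun x => conjc (g x) * g x) by apply: cbm; exact: contM.
  have b4 : bm (fun x => conjc (f x) * f x) by apply: cbm; exact: contM.
  rewrite intB; [|by apply: bmB => //; exact: bmZ..].
  rewrite !intB; [|by try exact: bmZ..].
  rewrite !intZ// intJ// !nsqE -/z.
  have N0 : (nsq g)%:C%C != 0 :> R[i] by rewrite eq_complex /= eqxx andbT.
  have cc : conjc c = conjc z / (nsq g)%:C%C.
    by rewrite /c conjcM conjc_inv conjc_real.
  have -> : (nsq f - cabs z ^+ 2 / nsq g)%:C%C =
      (nsq f)%:C%C - (cabs z ^+ 2)%:C%C / (nsq g)%:C%C :> R[i].
    by rewrite rmorphB rmorphM fmorphV.
  rewrite -mulcJ cc /c.
  by field.
have := nsq_ge0 (fun x => f x - c * conjc (g x)); rewrite key.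
by rewrite subr_ge0 ler_pdivrMr.
Qed.

Lemma nsq_subl f x : cont f -> nsq (fun y => f (x - y)) = nsq f.
Proof.
move=> cf; apply: complexI; rewrite -!nsqE.
rewrite (int_opp cG haar (f := fun y => conjc (f (x + y)) * f (x + y))).
  rewrite (int_translate haar x (f := fun y => conjc (f y) * f y))//.
  by apply: cbm; apply: contM => //; exact: contJ.
by apply: contM; [apply: contJ|]; exact: cont_translate.
Qed.

(** This turns L2 convergence into uniform convergence in the power method. *)
Lemma conv_bound f g x : cont f -> cont g ->
  cabs (conv f g x) ^+ 2 <= nsq f * nsq g.
Proof.
move=> cf cg; rewrite -(nsq_subl x cf).
by rewrite convE; apply: cauchy_schwarz => //; exact: cont_subl.
Qed.

Lemma nsq_le f c : cont f -> 0 <= c -> (forall x, cabs (f x) ^+ 2 <= c) ->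
  nsq f <= c.
Proof.
move=> cf c0 h; have := @int_le_cst _ _ mu (fun x => conjc (f x) * f x) c _ _.
rewrite nsqE cabs_real ger0_norm ?nsq_ge0//; apply.
  by apply: cbm; apply: contM => //; exact: contJ.
by move=> x; rewrite mulrC mulcJ cabs_real ger0_norm// sqr_ge0.
Qed.

End convolution.

(** * The power method for convolution operators *)

Section uniform_convergence.
Context {R : realType} {G : topologicalZmodType}.
Implicit Types (u w : nat -> G -> R[i]) (v t : G -> R[i]).

Definition ucvg u v := forall e : R, 0 < e -> exists N, forall n x,
  (N <= n)%N -> cabs (u n x - v x) <= e.

Lemma ucvg_uniq u v t : ucvg u v -> ucvg u t -> v = t.
Proof.
move=> uv ut; apply/funext => x; apply/eqP; rewrite -subr_eq0; apply/eqP.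
apply: cabs_le_eq0 => e e0; have e2 : 0 < e / 2 by rewrite divr_gt0.
have [N hN] := uv _ e2; have [M hM] := ut _ e2.
have -> : v x - t x = - (u (maxn N M) x - v x) + (u (maxn N M) x - t x) by ring.
rewrite (le_trans (cabsD _ _))// [leRHS]splitr cabsN.
by rewrite lerD ?hN ?hM ?leq_maxl ?leq_maxr.
Qed.

Lemma ucvg_sub u v (p : nat -> nat) : (forall n, (n <= p n)%N) -> ucvg u v ->
  ucvg (fun n => u (p n)) v.
Proof.
move=> np uv e e0; have [N hN] := uv _ e0; exists N => n x Nn.
by apply: hN; exact: leq_trans (np n).
Qed.

Lemma ucvgZ c u v : ucvg u v ->
  ucvg (fun n x => c * u n x) (fun x => c * v x).
Proof.
move=> uv e e0; have c1 : 0 < cabs c + 1 by rewrite ltr_wpDl ?cabs_ge0.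
have [N hN] := uv _ (divr_gt0 e0 c1); exists N => n x Nn.
rewrite -mulrBr cabsM -(divfK (lt0r_neq0 c1) e) mulrC.
by rewrite ler_pM ?cabs_ge0 ?hN// lerDl.
Qed.

Lemma ucvg_adj u v : ucvg u v -> ucvg (fun n => adj (u n)) (adj v).
Proof.
move=> uv e e0; have [N hN] := uv _ e0; exists N => n x Nn.
by rewrite /adj -rmorphB cabsJ hN.
Qed.

Lemma ucvg_cst v : ucvg (fun=> v) v.
Proof. by move=> e e0; exists 0%N => n x _; rewrite subrr cabs0 ltW. Qed.

Variable mu : probability (borel G) R.
Hypothesis cG : compact [set: G].

Lemma ucvg_conv u v w t : (forall n, cont (u n)) -> (forall n, cont (w n)) ->
  cont v -> cont t -> ucvg u v -> ucvg w t ->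
  ucvg (fun n => conv mu (u n) (w n)) (conv mu v t).
Proof.
move=> cu cw cv ct uv wt e e0.
have [A hA] := cont_bounded cG cv; have [B hB] := cont_bounded cG ct.
have A0 : 0 <= A by rewrite (le_trans (cabs_ge0 _) (hA 0)).
have B0 : 0 <= B by rewrite (le_trans (cabs_ge0 _) (hB 0)).
have AB0 : 0 < A + B + 1 by rewrite ltr_wpDl// addr_ge0.
pose d := Num.min 1 (e / (A + B + 1)).
have d0 : 0 < d by rewrite lt_min ltr01 divr_gt0.
have d1 : d <= 1 by rewrite ge_min lexx.
have de : d * (A + B + 1) <= e by rewrite -ler_pdivlMr// ge_min lexx orbT.
have [N hN] := uv _ d0; have [M hM] := wt _ d0.
exists (maxn N M) => n x; rewrite geq_max => /andP[Nn Mn].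
have bu : bm (w n) by exact: cont_bm.
have bt : bm t by exact: cont_bm.
rewrite !convE -intB; [|by apply: bm_conv..].
apply: int_le_cst => [|y]; first by apply: bmB; exact: bm_conv.
have -> : u n (x - y) * w n y - v (x - y) * t y =
  (u n (x - y) - v (x - y)) * (w n y - t y) + (u n (x - y) - v (x - y)) * t y
  + v (x - y) * (w n y - t y) by ring.
apply: le_trans de.
have h1 := hN n (x - y) Nn; have h2 := hM n y Mn.
have -> : d * (A + B + 1) = d * 1 + d * B + A * d by ring.
rewrite (le_trans (cabsD _ _))// lerD//; last first.
  by rewrite cabsM ler_pM ?cabs_ge0.
rewrite (le_trans (cabsD _ _))// lerD// cabsM ler_pM ?cabs_ge0//.
exact: le_trans d1.
Qed.

End uniform_convergence.

Section spectral.
Context {R : realType} {G : topologicalZmodType}.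
Variable mu : probability (borel G) R.
Hypotheses (cG : compact [set: G]) (haar : is_haar mu).
Local Notation I := (cintegral mu).
Local Notation bm := (@bm R G).
Local Notation conv := (conv mu).
Local Notation nsq := (nsq mu).
Implicit Types f g h : G -> R[i].

Let cbm f : cont f -> bm f.
Proof. exact: cont_bm. Qed.

Let cconv f g : cont f -> cont g -> cont (conv f g).
Proof. by move=> cf cg; apply: cont_conv => //; exact: cbm. Qed.

Let convA' f g h : cont f -> cont g -> cont h ->
  conv f (conv g h) = conv (conv f g) h.
Proof. by move=> *; apply: convA => //; exact: cbm. Qed.

Lemma nsqB f g : cont f -> cont g -> adj f = f -> adj g = g ->
  (nsq (fun x => f x - g x))%:C%C =
  (nsq f)%:C%C - conv f g 0 - conv g f 0 + (nsq g)%:C%C.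
Proof.
move=> cf cg af ag.
have E a b : adj a = a -> conv a b 0 = I (fun x => conjc (a x) * b x).
  by move=> {1}<-; rewrite convE; apply: eq_int => x; rewrite /adj sub0r opprK.
rewrite !E// -!nsqE.
have bb a b : cont a -> cont b -> bm (fun x => conjc (a x) * b x).
  by move=> ca cb; apply: cbm; apply: contM => //; exact: contJ.
rewrite -intB; [|exact: bb..].
rewrite -intB; [|by apply: bmB; exact: bb|exact: bb].
rewrite -intD; [|by do 2?[apply: bmB; last exact: bb]; exact: bb|exact: bb].
by apply: eq_int => x; rewrite rmorphB /=; ring.
Qed.

(** The power method.  If k is hermitian, the normalized even convolution
    powers of k converge uniformly to the orthogonal projection onto the
    eigenspace of the largest eigenvalue of convolution by [k * k]; the
    projection is again convolution by a continuous function.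

    The squared L2 norms [b n] of the powers of k are logarithmically convex and
    submultiplicative, hence have a growth rate lam, and
    [a n := b n / lam ^+ n.+1] decreases to a limit.  The normalized powers u
    satisfy |u m - u n|^2 = a (2m+1) - 2 a (m+n+1) + a (2n+1) in L2, so they
    form a Cauchy sequence; one more convolution by [k * k], which only multiplies by
    lam and shifts the index, makes it uniformly Cauchy.  Compactness enters
    through submultiplicativity, which gives [1 <= a n]: without it the limit
    could be zero. *)
Lemma power_iteration k : cont k -> adj k = k -> (exists x, k x != 0) ->
  exists2 lam : R, 0 < lam & exists u,
    [/\ cont u, adj u = u, conv u u = u & u 0 != 0] /\
    conv (conv k k) u = (fun x => lam%:C%C * u x) /\
    forall g, cont g -> conv g k = k -> conv g u = u.
Proof.
move=> ck ak [x0 kx0].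
(* [P n] is the convolution power of k of exponent n + 1. *)
pose P n := iter n (conv k) k.
have PS n : P n.+1 = conv k (P n) by [].
have cP n : cont (P n) by elim: n => //= n IH; exact: cconv.
have PP m n : conv (P m) (P n) = P (m + n).+1.
  elim: m => [//|m IH]; rewrite addSn [in LHS]PS [in RHS]PS -IH convA'//.
have aP n : adj (P n) = P n.
  by elim: n => //= n IH; rewrite adj_conv// IH ak.
pose b n := nsq (P n).
have bE n : P (n + n).+1 0 = (b n)%:C%C by rewrite -conv_adj0 aP PP.
have b_conv n : b n.+1 ^+ 2 <= b n * b n.+2.
  have := conv_bound cG haar 0 (cP n) (cP n.+2); rewrite PP.
  have -> : (n + n.+2).+1 = (n.+1 + n.+1).+1 by lia.
  by rewrite bE cabs_real real_normK// num_real.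
have b_sub m n : b (m + n).+1 <= b m * b n.
  rewrite /b -PP; apply: nsq_le => //; first exact: cconv.
    by rewrite mulr_ge0// nsq_ge0.
  by move=> x; exact: conv_bound.
have b0 n : 0 < b n.
  suff [//] : 0 < b n /\ 0 < b n.+1.
  elim: n => [|n [IH1 IH2]].
    have h : 0 < b 0%N by exact: (nsq_gt0 cG haar (x := x0)).
    split => //; apply: (nsq_gt0 cG haar (x := 0)) => //.
    by rewrite (bE 0%N) eq_complex /= eqxx andbT gt_eqF.
  split; first exact: IH2.
  have := lt_le_trans (exprn_gt0 2 IH2) (b_conv n).
  by rewrite pmulr_rgt0.
have [lam lam0 lamP] := growth_rate b0 b_conv b_sub.
have lX n : 0 < lam ^+ n by rewrite exprn_gt0.
pose a n := b n / lam ^+ n.+1.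
have a1 n : 1 <= a n by rewrite ler_pdivlMr// mul1r; have [] := lamP n.
have a_ni : nonincreasing_seq a.
  apply/nonincreasing_seqP => n; rewrite /a ler_pdivrMr// mulrAC ler_pdivlMr//.
  rewrite [lam ^+ n.+2]exprS mulrA [b n * _]mulrC ler_pM2r//.
  by have [] := lamP n.
have a_cvg : cvgn a.
  apply: nonincreasing_is_cvgn => //; exists 0; apply/lbP => _ [n _ <-].
  by rewrite (le_trans _ (a1 n)).
have a_cauchy (e : R) : 0 < e -> exists N, forall m n,
    (N <= m)%N -> (N <= n)%N -> a m - a n <= e.
  move=> e0; have e2 : 0 < e / 2 by rewrite divr_gt0.
  have /cvgrPdist_le/(_ _ e2)[N _ hN] := a_cvg.
  exists N => m n Nm Nn; have h1 := hN _ Nm; have h2 := hN _ Nn.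
  move: h1 h2; rewrite /= !ler_norml; lra.
pose s n : R[i] := ((lam ^+ n.+1)^-1)%:C%C.
(* The power of [conv k k] of exponent n + 1, normalized. *)
pose u n x := s n * P (n + n).+1 x.
have cu n : cont (u n) by apply: contZ; exact: cP.
have au n : adj (u n) = u n.
  apply/funext => x; rewrite /adj /u conjcM /s conjc_real.
  by rewrite -[in RHS](aP (n + n).+1).
have ss m n : s m * s n = s (m + n).+1.
  by rewrite /s -rmorphM -invfM -exprD; congr (_ ^-1)%:C%C; congr (_ ^+ _); lia.
have uu m n : conv (u m) (u n) = u (m + n).+1.
  rewrite /u convZl//; [|exact: contZ].
  rewrite convZr//; last exact: cbm.
  apply/funext => x; rewrite mulrA ss PP.
  have -> // : ((m + m).+1 + (n + n).+1).+1 = ((m + n).+1 + (m + n).+1).+1.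
  by lia.
have u0 n : u n 0 = (a n)%:C%C by rewrite /u bE /s /a -rmorphM mulrC.
have nuu m : (nsq (u m))%:C%C = (a (m + m).+1)%:C%C :> R[i].
  by rewrite -conv_adj0 au uu u0.
have nu m n : nsq (fun x => u m x - u n x) =
    a (m + m).+1 - a (m + n).+1 - a (m + n).+1 + a (n + n).+1.
  have := nsqB (cu m) (cu n) (au m) (au n).
  rewrite !nuu !uu !u0 [(n + m)%N]addnC.
  move: (a (m + m).+1) (a (m + n).+1) (a (n + n).+1) => A B D.
  by move=> /(congr1 (@complex.Re R)).
have Pu n : conv (P 1%N) (u n) = fun x => lam%:C%C * u n.+1 x.
  rewrite /u convZr//; last exact: cbm.
  have -> : s n = lam%:C%C * s n.+1.
    rewrite /s -rmorphM [lam ^+ n.+2]exprS invfM mulrA divff ?mul1r//.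
    exact: lt0r_neq0.
  rewrite PP; apply/funext => x; rewrite -mulrA.
  by have -> : (1 + (n + n).+1).+1 = (n.+1 + n.+1).+1 by lia.
have u_cauchy (e : R) : 0 < e -> exists N, forall m n x,
    (N <= m)%N -> (N <= n)%N -> cabs (u m x - u n x) <= e.
  move=> e0; pose d := (lam * e) ^+ 2 / (2 * b 1%N).
  have d0 : 0 < d by rewrite divr_gt0 ?exprn_gt0 ?mulr_gt0.
  have [N hN] := a_cauchy _ d0; exists N.+1 => -[//|m] [//|n] x Nm Nn.
  rewrite ltnS in Nm; rewrite ltnS in Nn.
  have lamE : lam = cabs (lam%:C%C : R[i]) by rewrite cabs_real gtr0_norm.
  rewrite -(ler_pM2l lam0) {1}lamE -cabsM mulrBr.
  have -> : lam%:C%C * u m.+1 x = conv (P 1%N) (u m) x by rewrite Pu.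
  have -> : lam%:C%C * u n.+1 x = conv (P 1%N) (u n) x by rewrite Pu.
  have cu' : cont (fun y => u m y - u n y) by exact: contB.
  have -> : conv (P 1%N) (u m) x - conv (P 1%N) (u n) x =
      conv (P 1%N) (fun y => u m y - u n y) x.
    rewrite !convE -intB; [|by apply: bm_conv => //; exact: cbm..].
    by apply: eq_int => y; rewrite mulrBr.
  have le0 : 0 <= lam * e by apply: mulr_ge0; exact: ltW.
  rewrite -ler_sqr ?nnegrE ?cabs_ge0//.
  rewrite (le_trans (conv_bound cG haar x (cP 1%N) cu'))// nu.
  have h1 := hN (m + m).+1 (m + n).+1; have h2 := hN (n + n).+1 (m + n).+1.
  have {}h1 : a (m + m).+1 - a (m + n).+1 <= d by apply: h1; lia.
  have {}h2 : a (n + n).+1 - a (m + n).+1 <= d by apply: h2; lia.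
  have -> : (lam * e) ^+ 2 = b 1%N * (2 * d).
    by rewrite /d; field; rewrite gt_eqF.
  have aux (x1 x2 x3 y : R) : x1 - x2 <= y -> x3 - x2 <= y ->
    x1 - x2 - x2 + x3 <= 2 * y by lra.
  by rewrite ler_pM2l; [exact: aux|exact: b0].
have [v cv uv] := cont_uniform_lim cu u_cauchy.
exists lam => //; exists v; split; first split => //.
- apply: (@ucvg_uniq _ _ u) => //; have := ucvg_adj uv.
  by under [X in ucvg X]eq_fun do rewrite au.
- apply: (@ucvg_uniq _ _ (fun n => u (n + n).+1)).
    have := ucvg_conv mu cG cu cu cv cv uv uv.
    by under [X in ucvg X]eq_fun do rewrite uu.
  by apply: ucvg_sub uv => n; lia.
- apply/eqP => v0; have h2 : 0 < 2^-1 :> R by rewrite invr_gt0.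
  have [N /(_ N 0 (leqnn _))] := uv _ h2.
  rewrite v0 subr0 u0 cabs_real ger0_norm; have := a1 N; lra.
split.
  apply: (@ucvg_uniq _ _ (fun n => conv (P 1%N) (u n))).
    exact: (ucvg_conv mu cG (fun=> cP 1%N) cu (cP 1%N) cv
      (ucvg_cst (P 1%N)) uv).
  under [X in ucvg X]eq_fun do rewrite Pu.
  by apply: ucvgZ; apply: (ucvg_sub (p := succn)) uv.
move=> e ce ek; apply: (@ucvg_uniq _ _ (fun n => conv e (u n))).
  exact: (ucvg_conv mu cG (fun=> ce) cu ce cv (ucvg_cst e) uv).
suff E n : conv e (u n) = u n by under [X in ucvg X]eq_fun do rewrite E.
rewrite /u convZr//; last exact: cbm.
have -> // : conv e (P (n + n).+1) = P (n + n).+1.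
by rewrite /= convA'// ek.
Qed.

End spectral.

(** * Idempotents, characters, and uniqueness of Fourier coefficients *)

Section characters.
Context {R : realType} {G : topologicalZmodType}.

Lemma cont_character (chi : dual R G) : cont chi.
Proof.
apply/contP => x e e0.
have /cvgrPdist_le/(_ e%:C%C _) := @character_continuous _ _ _ (dualP chi) x.
rewrite ltcR => /(_ e0); apply: filterS => y.
by rewrite distrC normr_cabs lecR.
Qed.

Lemma cabs_character (chi : dual R G) x : cabs (chi x) = 1.
Proof.
by have := character_norm (dualP chi) x; rewrite normr_cabs => /complexI.
Qed.

Lemma characterN (chi : dual R G) x : chi (- x) = conjc (chi x).
Proof.
apply: (mulfI (dual_neq0 chi x)); rewrite -(characterD (dualP chi)) subrr mulcJ.
rewrite cabs_character expr1n; apply: (mulfI (dual_neq0 chi 0)).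
by rewrite -(characterD (dualP chi)) addr0 mulr1.
Qed.

Lemma is_character_cont (f : G -> R[i]) : cont f ->
  (forall x, cabs (f x) = 1) -> (forall x y, f (x + y) = f x * f y) ->
  is_character f.
Proof.
move=> /contP cf f1 fD; split=> // x; last by rewrite normr_cabs f1.
apply/cvgrPdist_le => e e0.
have e0' : 0 < complex.Re e by move: e0; rewrite ltcE => /andP[].
have eE : e = (complex.Re e)%:C%C.
  by apply: eqcP => //=; move: e0; rewrite ltcE => /andP[/eqP].
have := cf x _ e0'; apply: filterS => y.
by rewrite distrC normr_cabs eE lecR.
Qed.

Variable mu : probability (borel G) R.
Hypotheses (cG : compact [set: G]) (haar : is_haar mu).
Local Notation I := (cintegral mu).
Local Notation bm := (@bm R G).
Local Notation conv := (conv mu).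
Local Notation nsq := (nsq mu).
Implicit Types f g h e : G -> R[i].

Let cbm f : cont f -> bm f.
Proof. exact: cont_bm. Qed.

Let cconv f g : cont f -> cont g -> cont (conv f g).
Proof. by move=> cf cg; apply: cont_conv => //; exact: cbm. Qed.

Let convA' f g h : cont f -> cont g -> cont h ->
  conv f (conv g h) = conv (conv f g) h.
Proof. by move=> *; apply: convA => //; exact: cbm. Qed.

(** Continuous hermitian convolution idempotents; they are the finite sums of
    distinct characters. *)
Definition idem e : Prop := [/\ cont e, adj e = e & conv e e = e].

Definition nonzero f : Prop := exists x, f x != 0.

Lemma nonzeroPn f : ~ nonzero f -> f = fun=> 0.
Proof.
move=> h; apply/funext => x; apply/eqP; apply: contra_notT h => fx.
by exists x.
Qed.

Lemma idem_0 e : idem e -> e 0 = (nsq e)%:C%C.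
Proof. by move=> [_ ae ee]; rewrite -conv_adj0 ae ee. Qed.

(** The squared norm d of an idempotent bounds its sup norm, hence d <= d^2. *)
Lemma idem_nsq_ge1 e : idem e -> nonzero e -> 1 <= nsq e.
Proof.
move=> ie [x ex]; have [ce ae ee] := ie.
have e0 : 0 < nsq e by exact: (nsq_gt0 cG haar (x := x)).
have : nsq e <= nsq e * nsq e.
  apply: nsq_le => //; first by rewrite mulr_ge0 ?ltW.
  by move=> y; rewrite -{1}ee; exact: conv_bound.
by rewrite -{1}[nsq e]mulr1 ler_pM2l.
Qed.

Lemma adjD f g : adj (fun x => f x + g x) = (fun x => adj f x + adj g x).
Proof. by apply/funext => x; rewrite /adj rmorphD. Qed.

Lemma adjZ c f : adj (fun x => c * f x) = (fun x => conjc c * adj f x).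
Proof. by apply/funext => x; rewrite /adj rmorphM. Qed.

Lemma idemB e e' : idem e -> idem e' -> conv e e' = e' ->
  idem (fun x => e x - e' x) /\
  nsq (fun x => e x - e' x) = nsq e - nsq e'.
Proof.
move=> ie ie' eE; have [ce ae ee] := ie; have [ce' ae' ee'] := ie'.
have E'e : conv e' e = e' by rewrite convC.
split; last first.
  apply: complexI; rewrite nsqB// eE E'e idem_0//.
  by rewrite !(rmorphD, rmorphB, rmorphN) /=; ring.
have E : (fun x => e x - e' x) = (fun x => e x + (-1) * e' x).
  by apply/funext => x; rewrite mulN1r.
have cN : cont (fun x => -1 * e' x) by exact: contZ.
split; first exact: contB.
  rewrite E adjD adjZ ae ae'; apply/funext => x.
  by rewrite rmorphN rmorph1.
rewrite E convDl//; last exact: contD.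
rewrite !convDr//; try exact: cbm.
rewrite !convZl// !convZr//; try exact: cbm.
by apply/funext => x; rewrite ee eE E'e ee'; ring.
Qed.

Definition minimal_idem e : Prop := [/\ idem e, nonzero e &
  forall e', idem e' -> nonzero e' -> conv e e' = e' -> e' = e].

(** Below every idempotent there is a minimal one, because squared norms are
    at least one and add up. *)
Lemma exists_minimal_idem e : idem e -> nonzero e ->
  exists2 m, minimal_idem m & conv e m = m.
Proof.
suff key n : nsq e < n%:R -> idem e -> nonzero e ->
    exists2 m, minimal_idem m & conv e m = m.
  apply: (key (Num.bound (nsq e))).
  by have := archi_boundP (nsq_ge0 mu e).
elim: n e => [e|n IH e en ie nze].
  by rewrite ltNge nsq_ge0.
have [mine|] := pselect (minimal_idem e).
  by exists e => //; have [] := ie.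
have [ce ae ee] := ie.
move=> nmin; have [e' [ie' nze' eE ne]] : exists e',
    [/\ idem e', nonzero e', conv e e' = e' & e' <> e].
  apply: contrapT => h; apply: nmin; split => // e' ie' nze' eE.
  by apply: contrapT => ne; apply: h; exists e'.
have [id nd] := idemB ie ie' eE.
have nzd : nonzero (fun x => e x - e' x).
  apply: contrapT => /nonzeroPn h; apply: ne; apply/funext => x.
  by apply/eqP; rewrite eq_sym -subr_eq0; have /= -> := congr1 (@^~ x) h.
have [|//|//|m mm mE] := IH e'.
  have := idem_nsq_ge1 id nzd; rewrite nd; move: en.
  by rewrite -[n.+1]addn1 natrD; lra.
exists m => //; have [[cm _ _] _ _] := mm; have [ce' _ _] := ie'.
by rewrite -mE convA'// eE.
Qed.

(** If w is hermitian in the ideal of a minimal idempotent e, the projection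
    found by the power method lies below e, hence is e, and [conv w w] is
    [lam * e].  Then half the sum of e and of w divided by the square root of
    lam is idempotent below e, hence 0 or e. *)
Lemma minimal_idem_hermitian e w : minimal_idem e -> cont w -> adj w = w ->
  conv e w = w -> exists c : R[i], w = fun x => c * e x.
Proof.
move=> [ie nze mine] cw aw ew; have [ce ae ee] := ie.
have [nzw|/nonzeroPn ->] := pselect (nonzero w); last first.
  by exists 0; apply/funext => x; rewrite mul0r.
have [lam lam0 [u [[cu au uu u0] [kuE ue]]]] :=
  power_iteration cG haar cw aw nzw.
have uE : u = e by apply: mine; [split|exists 0|exact: ue].
rewrite {}uE {u cu au uu u0 ue} in kuE.
have ww : conv w w = (fun x => lam%:C%C * e x).
  by rewrite -kuE -convA'// (convC cG haar cw ce) ew.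
pose r : R[i] := ((Num.sqrt lam)^-1)%:C%C.
have r0 : r != 0.
  by rewrite eq_complex /= eqxx andbT invr_eq0 gt_eqF// sqrtr_gt0.
have r2 : r * r * lam%:C%C = 1.
  rewrite /r -!rmorphM -expr2 exprVn sqr_sqrtr ?ltW// mulVf// gt_eqF//.
pose p x := 2^-1 * (e x + r * w x).
have crw : cont (fun x => r * w x) by exact: contZ.
have cerw : cont (fun x => e x + r * w x) by exact: contD.
have cp : cont p by exact: contZ.
have we : conv w e = w by rewrite convC.
have ip : idem p.
  split => //.
    rewrite /p adjZ adjD adjZ ae aw /r conjc_real; apply/funext => x.
    by rewrite conjc_inv conjc_nat.
  rewrite /p convZl// convZr//; last exact: cbm.
  rewrite convDl//.
  rewrite !convDr//; try exact: cbm.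
  rewrite !convZl// !convZr//; try exact: cbm.
  rewrite ee ew we ww; apply/funext => x.
  transitivity (2^-1 * (2^-1 * (e x + r * w x + (r * w x +
    (r * r * lam%:C%C) * e x)))); first by ring.
  by rewrite r2; move: (e x) (r * w x) => y z; field.
have ep : conv e p = p.
  by rewrite /p convZr ?convDr ?convZr ?ee ?ew//; try exact: cbm.
have [nzp|/nonzeroPn p0] := pselect (nonzero p).
  have pe := mine p ip nzp ep; exists r^-1; apply/funext => x.
  have := congr1 (@^~ x) pe; rewrite /p /= => h.
  apply: (mulfI r0); rewrite mulVKf//.
  have -> : r * w x = 2 * (2^-1 * (e x + r * w x)) - e x.
    by move: (e x) (r * w x) => y z; field.
  by rewrite h; ring.
exists (- r^-1); apply/funext => x.
have := congr1 (@^~ x) p0; rewrite /p /= => h.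
apply: (mulfI r0); rewrite mulNr mulrN mulVKf//.
have -> : r * w x = 2 * (2^-1 * (e x + r * w x)) - e x.
  by move: (e x) (r * w x) => y z; field.
by rewrite h; ring.
Qed.

(** The ideal of a minimal idempotent is a line, since it is spanned by its
    hermitian elements. *)
Lemma minimal_idem_ideal e f : minimal_idem e -> cont f -> conv e f = f ->
  exists c : R[i], f = fun x => c * e x.
Proof.
move=> me cf ef; have [[ce ae ee] _ _] := me.
have caf := cont_adj cf.
have eaf : conv e (adj f) = adj f by rewrite -{1}ae -adj_conv// ef.
have cN : cont (fun x => -1 * adj f x) by exact: contZ.
have [|||c hc] := minimal_idem_hermitian (w := fun x => f x + adj f x) me.
- exact: contD.
- by rewrite adjD adjK; apply/funext => x; rewrite addrC.
- by rewrite convDr ?ef ?eaf//; exact: cbm.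
have [|||d hd] := minimal_idem_hermitian
    (w := fun x => 'i%C * (f x + -1 * adj f x)) me.
- by apply: contZ; exact: contD.
- rewrite adjZ adjD adjZ adjK; apply/funext => x.
  by move: (f x) (adj f x) => [a b] [c0 d]; apply: eqcP => /=; ring.
- rewrite convZr ?convDr ?convZr ?ef ?eaf//; try exact: cbm.
  by apply: cbm; exact: contD.
exists (2^-1 * (c - 'i%C * d)); apply/funext => x.
have /= h1 := congr1 (@^~ x) hc; have /= h2 := congr1 (@^~ x) hd.
have i2 : 'i%C * 'i%C = -1 :> R[i] by rewrite -expr2 sqr_i.
have -> : 2^-1 * (c - 'i%C * d) * e x = 2^-1 * (c * e x - 'i%C * (d * e x)).
  by ring.
rewrite -h1 -h2 mulrA i2; by field.
Qed.

(** A minimal idempotent spans a translation-invariant line, and is thus a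
    multiple of a character. *)
Lemma minimal_idem_character e : minimal_idem e ->
  exists chi : dual R G, forall x, e x = e 0 * chi x.
Proof.
move=> me; have [ie nze _] := me; have [ce ae ee] := ie.
have e0 : e 0 != 0.
  rewrite idem_0// eq_complex /= eqxx andbT gt_eqF//.
  exact: lt_le_trans (idem_nsq_ge1 ie nze).
pose chi x := e x / e 0.
have eD a x : e (a + x) = chi a * e x.
  have [||c hc] := @minimal_idem_ideal e (fun x => e (a + x)) me.
  - exact: cont_translate.
  - by rewrite convC//; [rewrite conv_translate ee|exact: cont_translate].
  have /= -> := congr1 (@^~ x) hc; congr (_ * _).
  by have /= := congr1 (@^~ 0) hc; rewrite addr0 /chi => ->; rewrite mulfK.
have chiD x y : chi (x + y) = chi x * chi y by rewrite /chi eD /chi mulrA.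
have cchi : cont chi.
  by apply: (eq_cont _ (contZ (e 0)^-1 ce)) => x; rewrite mulrC.
have chi1 x : cabs (chi x) = 1.
  have chiN : chi (- x) = conjc (chi x).
    have eN y : e (- y) = conjc (e y) by rewrite -{2}ae /adj conjcK.
    by rewrite /chi conjcM conjc_inv -(eN 0) oppr0 eN.
  have : chi x * chi (- x) = 1 by rewrite -chiD subrr /chi divff.
  rewrite chiN mulcJ => /(congr1 (@complex.Re R)) /= /eqP.
  by rewrite sqrp_eq1 ?cabs_ge0// => /eqP.
exists (Dual (is_character_cont cchi chi1 chiD)) => x /=.
by rewrite /chi mulrCA divff// mulr1.
Qed.

Lemma conv_character f (chi : dual R G) : bm f ->
  conv chi f = fun x => chi x * fourier mu f chi.
Proof.
move=> bf; apply/funext => x; rewrite convE /fourier -intZ; last first.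
  by apply: bmM => //; apply: bmJ; exact/cbm/cont_character.
apply: eq_int => y.
by rewrite (characterD (dualP chi)) characterN -mulrA [_ * f y]mulrC.
Qed.

(** The completeness of the characters.  If f is not zero, neither is
    [k := conv (adj f) f]; the power method and the descent to a minimal
    idempotent provide a character that is an eigenvector of [conv k k] for a
    nonzero eigenvalue, and f cannot be orthogonal to it. *)
Lemma fourier_cont_inj f : cont f -> (forall chi, fourier mu f chi = 0) ->
  forall x, f x = 0.
Proof.
move=> cf f0 x0; apply/eqP; apply: contraPT f0 => fx0 f0.
have caf := cont_adj cf.
pose k := conv (adj f) f.
have ck : cont k by exact: cconv.
have ak : adj k = k by rewrite /k adj_conv// adjK convC.
have nzk : exists x, k x != 0.
  exists 0; rewrite /k conv_adj0 eq_complex /= eqxx andbT gt_eqF//.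
  exact: (nsq_gt0 cG haar (x := x0)).
have [lam lam0 [u [[cu au uu u0] [kuE ue]]]] :=
  power_iteration cG haar ck ak nzk.
have [|e me uE] := @exists_minimal_idem u _ (ex_intro _ 0 u0); first by split.
have [chi chiE] := minimal_idem_character me.
have [ie nze _] := me; have [ce ae ee] := ie; have [x1 ex1] := nze.
have fe : conv f e = fun=> 0.
  have -> : e = fun x => e 0 * chi x by apply/funext.
  rewrite convZr//; last by apply: cbm; exact: cont_character.
  rewrite convC//; last exact: cont_character.
  rewrite conv_character; last exact: cbm.
  by apply/funext => x; rewrite f0 !mulr0.
have kke : conv (conv k k) e = fun x => lam%:C%C * e x.
  rewrite -uE convA' //; last exact: cconv.
  by rewrite kuE convZl// uE.
have ke : conv k e = fun=> 0.
  rewrite /k -convA'// fe; apply/funext => x; rewrite convE.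
  by rewrite -[RHS](int_cst mu); apply: eq_int => y; rewrite mulr0.
have : lam%:C%C * e x1 = 0.
  rewrite -[LHS]/((fun x => lam%:C%C * e x) x1) -kke -convA'// ke convE.
  by rewrite -[RHS](int_cst mu); apply: eq_int => y; rewrite mulr0.
move=> /eqP; rewrite mulf_eq0 (negPf ex1) orbF eq_complex /= eqxx andbT.
by rewrite gt_eqF.
Qed.

Hypothesis hG : hausdorff_space G.

(** Convolution by continuous functions reduces the case of bounded functions to
    that of continuous ones. *)
Lemma fourier_ae_inj h : bm h -> (forall chi, fourier mu h chi = 0) ->
  {ae mu, forall x : borel G, h x = 0}.
Proof.
move=> bh h0; apply: cont_orthogonal_ae0 => // f cf.
have cf' : cont (fun x => f (- x)) by exact: cont_opp.
have -> : I (fun x => f x * h x) = conv (fun x => f (- x)) h 0.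
  by rewrite convE; apply: eq_int => x; rewrite sub0r opprK.
apply: fourier_cont_inj => [|chi]; first exact: cont_conv.
pose H (p : G * G) := conjc (chi p.1) * f (- (p.1 - p.2)).
have cchi := cont_character chi.
have cH : cont H.
  apply: contM; last exact: (cont_sub cf').
  apply: (@cont_comp _ _ _ (fun p : G * G => p.1) (fun y => conjc (chi y))).
    by move=> p; exact: cvg_fst.
  exact: contJ.
have E := fubini_cont cG mu cH bh; rewrite /H /= in E.
rewrite /fourier.
transitivity (I (fun x => I (fun y => conjc (chi x) * f (- (x - y)) * h y))).
  apply: eq_int => x; rewrite mulrC convE -intZ; last first.
    exact: (bm_conv cG x cf' bh).
  by apply: eq_int => y; rewrite mulrA.
rewrite E.
transitivity (I (fun y =>
    fourier mu (fun x => f (- x)) chi * (h y * conjc (chi y)))).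
  apply: eq_int => y; rewrite mulrA mulrAC; congr (_ * _).
  rewrite -(int_translate haar y (f := fun x => conjc (chi x) * f (- (x - y)))).
    rewrite /fourier -intZr; last first.
      by apply: bmM; apply: cbm => //; exact: contJ.
    apply: eq_int => x; rewrite addrAC subrr add0r (characterD (dualP chi)).
    by rewrite conjcM mulrC [conjc (chi y) * _]mulrC mulrA.
  apply: cbm; apply: contM; first exact: contJ.
  by apply: (eq_cont _ (cont_translate (- y) cf')) => x; rewrite addrC.
rewrite intZ; last by apply: bmM => //; apply: cbm; exact: contJ.
have -> : I (fun y => h y * conjc (chi y)) = fourier mu h chi by [].
by rewrite h0 mulr0.
Qed.

End characters.

(** * Fourier inversion and the norm of A(G) *)

Section absolutely_summable.
Context {R : realType} {T : choiceType} (a : T -> R) (A : R).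
Hypothesis aA : (\esum_(i in [set: T]) (a i)%:E = A%:E)%E.

Lemma finite_sum_le (s : seq T) : uniq s -> \sum_(i <- s) a i <= A.
Proof.
move=> us; rewrite -lee_fin -aA -sumEFin; apply: esum_ge.
by exists [set` s]; [split|rewrite -fsbig_seq].
Qed.

Lemma finite_sum_tail (e : R) : 0 < e -> exists2 s : seq T, uniq s &
  forall t, uniq t -> (forall i, i \in t -> i \notin s) ->
    \sum_(i <- t) a i <= e.
Proof.
move=> e0; have := aA; rewrite /esum; set S := (X in ereal_sup X) => SA.
have [|_ [X [fX _] <-]] := @ub_ereal_sup_adherent _ S _ e0; first by rewrite SA.
rewrite SA fsbig_finite//= sumEFin -EFinB lte_fin => lX.
exists (enum_fset (fset_set X)) => [|t ut ts]; first exact: fset_uniq.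
have := @finite_sum_le (enum_fset (fset_set X) ++ t).
rewrite cat_uniq ut fset_uniq andbT /= big_cat /= => h.
have {}h := h _; rewrite -(lerD2l (\sum_(i <- fset_set X) a i)).
apply: le_trans (h _) _; last by rewrite -lerBlDr ltW.
by apply/hasPn => i /ts.
Qed.

End absolutely_summable.

Section inversion.
Context {R : realType} {G : topologicalZmodType}.
Variable mu : probability (borel G) R.
Hypotheses (cG : compact [set: G]) (haar : is_haar mu).
Hypothesis hG : hausdorff_space G.
Local Notation I := (cintegral mu).
Local Notation bm := (@bm R G).
Implicit Types f g h : G -> R[i].

Let cbm f : cont f -> bm f.
Proof. exact: cont_bm. Qed.

Lemma characterV (gamma : dual R G) x : conjc (gamma x) = (gamma x)^-1.
Proof.
apply: (mulfI (dual_neq0 gamma x)); rewrite divff ?dual_neq0// mulcJ.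
by rewrite cabs_character expr1n.
Qed.

(** A nontrivial character is multiplied by a constant other than 1 under some
    translation. *)
Lemma int_character (chi : dual R G) : I chi = (chi == 0)%:R.
Proof.
have [->|n0] := eqVneq chi 0.
  by rewrite -[RHS](int_cst mu); apply: eq_int.
have [a ha] : exists a, chi a != 1.
  apply: contrapT => h; move/eqP: n0; apply; apply: dual_eq => x.
  by apply/eqP; apply: contra_notT h => hx; exists x.
have bchi := cbm (cont_character chi).
have := int_translate haar a bchi.
rewrite (@eq_int _ _ _ _ (fun x => chi a * chi x)); last first.
  by move=> x; rewrite (characterD (dualP chi)).
rewrite intZ// => /eqP; rewrite -subr_eq0 -{2}[I chi]mul1r -mulrBl mulf_eq0.
by rewrite subr_eq0 (negPf ha) => /eqP.
Qed.

Lemma fourier_character (chi gamma : dual R G) :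
  fourier mu chi gamma = (chi == gamma)%:R.
Proof.
rewrite -subr_eq0 -int_character; apply: eq_int => x.
by rewrite characterV.
Qed.

Lemma fourierE f gamma :
  fourier mu f gamma = I (fun x => f x * conjc (gamma x)).
Proof. by []. Qed.

Lemma bm_fourier f (gamma : dual R G) : bm f ->
  bm (fun x => f x * conjc (gamma x)).
Proof.
by move=> bf; apply: bmM => //; apply: cbm; apply: contJ; exact: cont_character.
Qed.

Lemma fourierB f g gamma : bm f -> bm g ->
  fourier mu (fun x => f x - g x) gamma =
  fourier mu f gamma - fourier mu g gamma.
Proof.
move=> bf bg; rewrite !fourierE -intB; [|exact: bm_fourier..].
by apply: eq_int => x; rewrite mulrBl.
Qed.

Lemma fourier_le f gamma (c : R) : bm f -> (forall x, cabs (f x) <= c) ->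
  cabs (fourier mu f gamma) <= c.
Proof.
move=> bf fc; apply: int_le_cst => [|x]; first exact: bm_fourier.
by rewrite cabsM cabsJ cabs_character mulr1.
Qed.

Lemma fourier_trig_poly (s : seq (dual R G)) (c : dual R G -> R[i]) gamma :
  uniq s -> fourier mu (fun x => \sum_(chi <- s) c chi * chi x) gamma =
    if gamma \in s then c gamma else 0.
Proof.
move=> us; rewrite fourierE.
rewrite (@eq_int _ _ _ _ (fun x =>
    \sum_(chi <- s) c chi * (chi x * conjc (gamma x)))).
  have bc (chi : dual R G) : bm (fun x => chi x * conjc (gamma x)).
    by apply: bm_fourier; exact/cbm/cont_character.
  rewrite int_sum => [|chi _]; last exact: bmZ.
  rewrite (eq_bigr (fun chi => if chi == gamma then c chi else 0)); last first.
    move=> chi _; rewrite intZ// -fourierE fourier_character.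
    by case: eqP => _; rewrite ?mulr1 ?mulr0.
  rewrite -big_mkcond -big_filter.
  case: ifPn => gs.
    by rewrite filter_pred1_uniq// big_seq1.
  rewrite (@eq_in_filter _ _ pred0) ?filter_pred0 ?big_nil// => chi cs /=.
  by apply: contraNF gs => /eqP <-.
by move=> x; rewrite mulr_suml; apply: eq_bigr => chi _; rewrite mulrA.
Qed.

(** Absolutely convergent Fourier series: the partial sums are uniformly
    Cauchy, their limit has the right Fourier coefficients, and it coincides
    with f by uniqueness. *)
Lemma sup_le_A_norm f (A : R) : bm f -> A_norm mu f = A%:E ->
  {ae mu, forall x : borel G, cabs (f x) <= A}.
Proof.
move=> bf fA; pose F gamma := cabs (fourier mu f gamma).
have F0 gamma : 0 <= F gamma by exact: cabs_ge0.
have tail n : exists s : seq (dual R G), uniq s /\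
    forall t, uniq t -> (forall i, i \in t -> i \notin s) ->
      \sum_(i <- t) F i <= n.+1%:R^-1.
  have [|s us hs] := finite_sum_tail fA (e := n.+1%:R^-1).
    by rewrite invr_gt0.
  by exists s.
have [s hs] := choice tail.
pose u n x := \sum_(chi <- s n) fourier mu f chi * chi x.
have cu n : cont (u n).
  by apply: cont_sum => chi _; apply: contZ; exact: cont_character.
have Fx chi x : cabs (fourier mu f chi * chi x) = F chi.
  by rewrite cabsM cabs_character mulr1.
have u_diff m n x : cabs (u m x - u n x) <= n.+1%:R^-1 + m.+1%:R^-1.
  have [um tm] := hs m; have [un tn] := hs n.
  pose g chi := fourier mu f chi * chi x.
  have E : \sum_(chi <- s m | chi \in s n) g chi =
           \sum_(chi <- s n | chi \in s m) g chi.
    rewrite -[LHS]big_filter -[RHS]big_filter; apply: perm_big.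
    apply: uniq_perm; rewrite ?filter_uniq// => chi.
    by rewrite !mem_filter andbC.
  have -> : u m x - u n x = \sum_(chi <- [seq c <- s m | c \notin s n]) g chi -
      \sum_(chi <- [seq c <- s n | c \notin s m]) g chi.
    rewrite /u (bigID (fun c => c \in s n))/= E.
    rewrite [X in _ - X](bigID (fun c => c \in s m))/= !big_filter; ring.
  rewrite (le_trans (cabsD _ _))// cabsN lerD// (le_trans (cabs_sum _ _ _))//.
    under eq_bigr do rewrite Fx.
    by apply: tn => [|chi]; rewrite ?filter_uniq// mem_filter => /andP[].
  under eq_bigr do rewrite Fx.
  by apply: tm => [|chi]; rewrite ?filter_uniq// mem_filter => /andP[].
have small (e : R) : 0 < e -> exists N, forall n, (N <= n)%N -> n.+1%:R^-1 <= e.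
  move=> e0; exists (Num.truncn e^-1) => n Nn.
  rewrite -[leRHS]invrK lef_pV2 ?posrE ?invr_gt0//.
  rewrite (le_trans (ltW (truncnS_gt _)))// ler_nat ltnS//.
have [|S cS uS] := @cont_uniform_lim _ _ u cu.
  move=> e e0; have [N hN] := small (e / 2) (divr_gt0 e0 (ltr0Sn _ _)).
  exists N => m n x Nm Nn; rewrite (le_trans (u_diff m n x))//.
  by rewrite [leRHS]splitr lerD ?hN.
have SA x : cabs (S x) <= A.
  apply/ler_addgt0Pl => e e0; have [N hN] := uS _ e0.
  rewrite -[S x](subrK (u N x)) (le_trans (cabsD _ _))//.
  rewrite lerD//; first by rewrite cabs_distC hN.
  rewrite (le_trans (cabs_sum _ _ _))//; under eq_bigr do rewrite Fx.
  by apply: (finite_sum_le fA); have [] := hs N.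
have Sf gamma : fourier mu S gamma = fourier mu f gamma.
  apply/eqP; rewrite -subr_eq0; apply/eqP; apply: cabs_le_eq0 => e e0.
  have e2 : 0 < e / 2 by rewrite divr_gt0.
  have [N hN] := uS _ e2; have [M hM] := small _ e2.
  pose n := maxn N M; have [us tn] := hs n.
  have Nn : (N <= n)%N by rewrite leq_maxl.
  have Mn : (M <= n)%N by rewrite leq_maxr.
  have -> : fourier mu S gamma - fourier mu f gamma =
    - (fourier mu (u n) gamma - fourier mu S gamma) +
    (fourier mu (u n) gamma - fourier mu f gamma) by ring.
  rewrite (le_trans (cabsD _ _))// [leRHS]splitr cabsN lerD//.
    rewrite -fourierB; [|exact: cbm..].
    by apply: fourier_le => [|x]; [by apply: cbm; exact: contB|exact: hN].
  rewrite fourier_trig_poly//; case: ifPn => gs.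
    by rewrite subrr cabs0 ltW.
  rewrite sub0r cabsN (le_trans _ (hM _ Mn))//.
  have := tn [:: gamma]; rewrite big_seq1; apply => // chi.
  by rewrite inE => /eqP ->.
have bS := cbm cS.
have fS0 gamma : fourier mu (fun x => f x - S x) gamma = 0.
  by rewrite fourierB// Sf subrr.
have := fourier_ae_inj cG haar hG (bmB bf bS) fS0.
apply: filterS => x /eqP; rewrite subr_eq0 => /eqP ->.
exact: SA.
Qed.

Lemma measurable_cabs f : cintegrable mu f ->
  measurable_fun [set: borel G] (fun x => cabs (f x)).
Proof.
move=> [/measurable_int fR /measurable_int fI].
under eq_fun do rewrite cabsE.
have mh : measurable_fun [set: borel G]
    (fun x => complex.Re (f x) ^+ 2 + complex.Im (f x) ^+ 2).
  by apply: measurable_funD; apply: measurable_funX; apply/measurable_EFinP.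
exact: (measurableT_comp (continuous_measurable_fun (@sqrt_continuous R)) mh).
Qed.

(** Resetting f on a null set does not change its Fourier coefficients. *)
Lemma truncate_bounded f (M : R) : cintegrable mu f -> 0 <= M ->
  {ae mu, forall x : borel G, cabs (f x) <= M} ->
  exists g, [/\ bm g, forall x, cabs (g x) <= M,
    {ae mu, forall x : borel G, g x = f x} &
    forall gamma, fourier mu g gamma = fourier mu f gamma].
Proof.
move=> fi M0 fM; have [/measurable_int fR /measurable_int fI] := fi.
pose E := [set x : borel G | cabs (f x) <= M].
have mE : measurable E.
  rewrite (_ : E = (fun x => cabs (f x)) @^-1` `]-oo, M]); last first.
    by apply/seteqP; split=> x; rewrite /E /= in_itv.
  by rewrite -[X in measurable X]setTI; apply: measurable_cabs.
pose g x := if x \in E then f x else 0.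
have gM x : cabs (g x) <= M.
  rewrite /g; case: ifPn => [xE|_]; last by rewrite cabs0.
  exact: (set_mem xE).
have gE x : g x = (\1_E x : R)%:C%C * f x.
  by rewrite /g indicE; case: (x \in E); rewrite ?mul1r ?mul0r.
have bg : bm g.
  split; last by exists M.
    under eq_fun do rewrite gE cReM /= mul0r subr0.
    by apply: measurable_funM; [exact: measurable_indic|apply/measurable_EFinP].
  under eq_fun do rewrite gE cImM /= mul0r addr0.
  by apply: measurable_funM; [exact: measurable_indic|apply/measurable_EFinP].
have gf : {ae mu, forall x : borel G, g x = f x}.
  by apply: filterS fM => x fx; rewrite /g mem_set.
exists g; split => // gamma; rewrite !fourierE.
have [cR cI _] := cbm (contJ (cont_character gamma)).
have [bR bI _] := bm_fourier gamma bg.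
have {}fR : measurable_fun [set: borel G] (fun x => complex.Re (f x)).
  exact/measurable_EFinP.
have {}fI : measurable_fun [set: borel G] (fun x => complex.Im (f x)).
  exact/measurable_EFinP.
apply: eqcP => /=; congr fine; apply: ae_eq_integral => //.
- exact/measurable_EFinP.
- apply/measurable_EFinP; under eq_fun do rewrite cReM.
  by apply: measurable_funB; exact: measurable_funM.
- by apply: filterS gf => x -> _.
- exact/measurable_EFinP.
- apply/measurable_EFinP; under eq_fun do rewrite cImM.
  by apply: measurable_funD; exact: measurable_funM.
- by apply: filterS gf => x -> _.
Qed.

End inversion.

(** * A Bernstein inequality at the origin *)

Section interpolation.
Context {R : realFieldType}.

(** The squares of the odd numbers.  The interpolation weights at 0 of these
    nodes decay like 1 / (2j + 1), so that the formula for the derivative at 0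
    obtained below has total mass O(m); with the squares of all the integers the
    weights would not decay, at the cost of a factor log m. *)
Definition osq (i : nat) : R := (2 * i%:R + 1) ^+ 2.

Lemma osq_gt0 i : 0 < osq i.
Proof. by rewrite exprn_gt0// ltr_wpDl// mulr_ge0. Qed.

Lemma osq_inj : injective osq.
Proof.
move=> i j /eqP; rewrite eqrXn2// ?addr_ge0 ?mulr_ge0//.
by move=> /eqP/addIr/mulfI h; apply/eqP; rewrite -(eqr_nat R) h.
Qed.

Lemma osqB i j : osq i - osq j = 4 * (i%:R - j%:R) * (i + j + 1)%:R.
Proof. by rewrite /osq -addnA !natrD; ring. Qed.

(** The value at 0 of the Lagrange interpolation polynomial of the node
    [osq j] among [osq 0], ..., [osq (m - 1)]. *)
Definition lag0 (m j : nat) : R :=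
  \prod_(0 <= i < m | i != j) (osq i / (osq i - osq j)).

Lemma lag0_sum m r : (r < m)%N ->
  \sum_(j < m) lag0 m j * osq j ^+ r = (r == 0)%:R.
Proof.
move=> rm; have m0 : (0 < m)%N by exact: leq_ltn_trans rm.
have sX : (size ('X^r : {poly R}) <= m)%N by rewrite size_polyXn.
have := congr1 (fun p => p.[0]) (lagrange_gen m0 osq_inj sX).
rewrite hornerXn expr0n => ->; rewrite horner_sum; apply: eq_bigr => j _.
rewrite hornerM hornerC hornerXn mulrC; congr (_ * _).
rewrite lagrangeE// ?hornerM ?hornerC; last exact: osq_inj.
rewrite /lag0 big_mkord !horner_prod -prodfV -big_split /=.
apply: eq_bigr => i ij; rewrite !hornerXsubC sub0r.
by rewrite -[osq i - osq j]opprB invrN mulrN -mulNr mulrC.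
Qed.

Lemma osq_dist i j : (i <= j)%N ->
  `|osq i - osq j| = 4 * ((j - i) * (i + j + 1))%:R.
Proof.
move=> ij; have -> : osq i - osq j = - (4 * ((j - i) * (i + j + 1))%:R).
  by rewrite natrM natrB// osqB; ring.
by rewrite normrN ger0_norm// mulr_ge0.
Qed.

Lemma prod_osq_dist_lt j n : (n <= j)%N ->
  (j - n)`!%:R * \prod_(0 <= i < n) `|osq i - osq j| = 4 ^+ n * (j + n)`!%:R.
Proof.
elim: n => [|n IH] nj; first by rewrite big_nil subn0 addn0 expr0 mulr1 mul1r.
rewrite big_nat_recr//= osq_dist; last exact: ltnW.
have := IH (ltnW nj).
have -> : (j - n = (j - n.+1).+1)%N by lia.
have -> : (n + j + 1 = (j + n).+1)%N by lia.
rewrite addnS !factS exprS !natrM => E.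
rewrite [RHS]mulrACA -E; ring.
Qed.

Lemma prod_osq_dist (j d : nat) :
  (2 * j + 1)%:R * \prod_(0 <= i < j + 1 + d | i != j) `|osq i - osq j| =
  4 ^+ (j + d) * (d`! * (2 * j + 1 + d)`!)%:R.
Proof.
elim: d => [|d IH].
  rewrite !addn0 !addn1 big_mkcond big_nat_recr//= eqxx mulr1.
  rewrite (eq_big_nat _ _ (F2 := fun i => `|osq i - osq j|)); last first.
    by move=> i /andP[_ ij]; rewrite ltn_eqF.
  have := prod_osq_dist_lt (leqnn j); rewrite subnn fact0 mul1r => ->.
  by rewrite mulrCA -natrM mul1n mul2n -addnn factS.
rewrite [(j + 1 + d.+1)%N]addnS big_mkcond big_nat_recr; last by rewrite addn1.
rewrite -big_mkcond /= ifT; last by lia.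
rewrite mulrA IH distrC osq_dist; last by lia.
have -> : (j + 1 + d - j = d.+1)%N by lia.
have -> : (j + (j + 1 + d) + 1 = (2 * j + 1 + d).+1)%N by lia.
rewrite !addnS !factS exprS !natrM; ring.
Qed.

Lemma fact_prod_le (j d : nat) :
  ((j + d)`! * (j + d + 1)`! <= d`! * (2 * j + 1 + d)`!)%N.
Proof.
elim: j => [|j IH] in d *; first by rewrite muln0 !add0n addn1 add1n.
have := IH d.+1; rewrite -addSnnS => /leq_trans; apply.
have -> : (2 * j.+1 + 1 + d = (2 * j + 1 + d.+1).+1)%N by lia.
rewrite !factS -mulnA [leqRHS]mulnCA leq_mul2r; lia.
Qed.

(** A partial Wallis product. *)
Lemma prod_osq_le n :
  n.+1%:R * \prod_(0 <= i < n.+1) osq i <=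
  (2 * n + 1)%:R * (4 ^+ n * (n`! * n.+1`!)%:R).
Proof.
have S1 k : k.+1%:R = k%:R + 1 :> R by rewrite -addn1 natrD.
have S2 k : (2 * k + 1)%:R = 2 * k%:R + 1 :> R by rewrite natrD natrM.
elim: n => [|n IH].
  by rewrite big_nat1 /osq mulr0 add0r expr1n expr0 !mul1r.
rewrite big_nat_recr//=; move: IH.
move: (\prod_(0 <= i < n.+1) osq i) => P.
have -> : 4 ^+ n.+1 * (n.+1`! * n.+2`!)%:R =
    4 * ((n%:R + 1) * (n%:R + 2)) * (4 ^+ n * (n`! * n.+1`!)%:R) :> R.
  rewrite [n.+2`!]factS [in X in (X * _)%N]factS !natrM !S1 exprS; ring.
have : 0 <= 4 ^+ n * (n`! * n.+1`!)%:R :> R by rewrite mulr_ge0// exprn_ge0.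
move: (4 ^+ n * _) => Q Q0; rewrite /osq !S2 !S1.
have : 0 <= n%:R :> R by []; move: (n%:R) => x x0 IH.
have h : P * (2 * x + 3) <= 4 * (x + 1) * Q.
  rewrite -(@ler_pM2l _ (x + 1)) ?ltr_wpDl//.
  have : (x + 1) * P * (2 * x + 3) <= (2 * x + 1) * Q * (2 * x + 3).
    by apply: ler_wpM2r => //; lra.
  rewrite mulrA => /le_trans; apply.
  rewrite -subr_ge0 (_ : _ - _ = Q) //; ring.
rewrite [leLHS](_ : _ = (x + 2) * (2 * x + 3) * (P * (2 * x + 3))); last first.
  by ring.
rewrite [leRHS](_ : _ = (x + 2) * (2 * x + 3) * (4 * (x + 1) * Q)); last first.
  by ring.
by apply: ler_wpM2l => //; apply: mulr_ge0; lra.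
Qed.

(** The numerators multiply to a Wallis product, bounded by prod_osq_le; the
    denominators are products of factorials, smallest for [j = 0]. *)
Lemma lag0_le m j : (j < m)%N -> `|lag0 m j| * (2 * j%:R + 1) <= 2.
Proof.
move=> jm; have [d mE] : exists d, m = (j + 1 + d)%N.
  by exists (m - j.+1)%N; lia.
have := prod_osq_dist j d; rewrite -mE.
set q := \prod_(0 <= i < m | i != j) _ => qE.
set a := 2 * j%:R + 1; have a0 : 0 < a by rewrite ltr_wpDl// mulr_ge0.
have aE : (2 * j + 1)%:R = a by rewrite natrD natrM.
set Y := \prod_(0 <= i < m) osq i.
have YE : Y = a ^+ 2 * \prod_(0 <= i < m | i != j) osq i.
  by rewrite /Y (bigD1_seq j) ?mem_index_iota ?iota_uniq//= -/a.
have q0 : 0 < q.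
  rewrite /q big_seq_cond prodr_gt0// => i /andP[_ ij].
  by rewrite normr_gt0 subr_eq0 (inj_eq osq_inj).
have lagE : `|lag0 m j| * a = Y / (a * q).
  rewrite /lag0 normr_prod; under eq_bigr do rewrite normrM normfV.
  rewrite big_split /= prodfV -/q YE.
  rewrite (eq_bigr osq) => [|i _]; last by rewrite ger0_norm// ltW// osq_gt0.
  by field; rewrite !gt_eqF.
rewrite lagE ler_pdivrMr ?mulr_gt0// -aE qE.
have nE : m = (j + d).+1 by lia.
rewrite /Y nE -(@ler_pM2l _ (j + d).+1%:R) ?ltr0n//.
rewrite (le_trans (prod_osq_le _))//.
set E := 4 ^+ (j + d); have E0 : 0 <= E by rewrite exprn_ge0.
have h : ((j + d)`! * (j + d).+1`!)%:R <= (d`! * (2 * j + 1 + d)`!)%:R :> R.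
  by rewrite ler_nat -addn1; exact: fact_prod_le.
rewrite [leRHS]mulrA ler_pM ?mulr_ge0// ?ler_wpM2l//.
by rewrite -natrM ler_nat; lia.
Qed.

Lemma sum_inv_osq m : \sum_(j < m) (osq j)^-1 <= 2.
Proof.
suff h n : \sum_(j < n.+1) (osq j)^-1 <= 2 - n.+1%:R^-1.
  case: m => [|n]; first by rewrite big_ord0.
  by rewrite (le_trans (h n))// gerBl invr_ge0.
elim: n => [|n IH].
  by rewrite big_ord1 /osq mulr0 add0r expr1n invr1; lra.
rewrite big_ord_recr /= (le_trans (lerD IH (lexx _)))//.
rewrite -addrA lerD2l /osq -[n.+2%:R]natr1 -[n.+1%:R]natr1.
have : 0 <= n%:R :> R by []; move: n%:R => x x0.
rewrite -subr_ge0.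
have -> : - (x + 1 + 1)^-1 - (- (x + 1)^-1 + ((2 * (x + 1) + 1) ^+ 2)^-1) =
  (3 * x ^+ 2 + 9 * x + 7) / ((x + 1) * (x + 2) * (2 * x + 3) ^+ 2).
  by field; apply/and3P; split; apply: lt0r_neq0; lra.
apply: divr_ge0; first by have := sqr_ge0 x; lra.
by apply: mulr_ge0; [apply: mulr_ge0; lra|exact: sqr_ge0].
Qed.

(** The nodes [node m j] and their opposites lie in [-1/2, 1/2], and the
    antisymmetric combination of values with weights [weight m j / 2] is the
    derivative at 0 of every polynomial of degree at most [2 * m].  Using only
    half of [-1, 1] makes it small on monomials of higher degree. *)
Definition node (m j : nat) : R := (2 * j%:R + 1) / (4 * m%:R).

Definition weight (m j : nat) : R := lag0 m j / node m j.

Lemma node_gt0 m j : (0 < m)%N -> 0 < node m j.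
Proof.
by move=> m0; rewrite divr_gt0// ?mulr_gt0 ?ltr0n// ltr_wpDl// mulr_ge0.
Qed.

Lemma node_le_half m j : (j < m)%N -> node m j <= 2^-1.
Proof.
move=> jm; have m0 : 0 < m%:R :> R by rewrite ltr0n (leq_ltn_trans _ jm).
rewrite ler_pdivrMr ?mulr_gt0//.
have : j%:R + 1 <= m%:R :> R by rewrite natr1 ler_nat.
lra.
Qed.

Lemma lag0_le2 m j : (j < m)%N -> `|lag0 m j| <= 2.
Proof.
move=> jm; apply: le_trans (lag0_le jm); rewrite ler_peMr//.
by rewrite lerDr mulr_ge0.
Qed.

Lemma sum_weight_le m : (0 < m)%N -> \sum_(j < m) `|weight m j| <= 16 * m%:R.
Proof.
move=> m0; have mR : 0 < m%:R :> R by rewrite ltr0n.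
apply: (@le_trans _ _ (\sum_(j < m) (8 * m%:R) * (osq j)^-1)); last first.
  by rewrite -mulr_sumr; have := sum_inv_osq m; nra.
apply: ler_sum => j _.
rewrite /weight normrM normfV (gtr0_norm (node_gt0 j m0)).
rewrite /node.
have a0 : 0 < 2 * j%:R + 1 :> R by rewrite ltr_wpDl// mulr_ge0.
rewrite invf_div mulrA ler_pdivrMr// /osq.
have -> : 8 * m%:R / (2 * j%:R + 1) ^+ 2 * (2 * j%:R + 1) =
    4 * m%:R * (2 / (2 * j%:R + 1)) :> R by field; rewrite gt_eqF.
rewrite mulrC ler_wpM2l ?mulr_ge0// ler_pdivlMr//.
exact: lag0_le.
Qed.

Lemma moment_odd m r : (0 < m)%N ->
  \sum_(j < m) weight m j * node m j ^+ (2 * r).+1 =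
  (4 * m%:R) ^- (2 * r) * \sum_(j < m) lag0 m j * osq j ^+ r.
Proof.
move=> m0; have mR : 4 * m%:R != 0 :> R by rewrite gt_eqF// mulr_gt0// ltr0n.
rewrite mulr_sumr; apply: eq_bigr => j _.
rewrite /weight exprS mulrA divfK ?gt_eqF ?node_gt0//.
rewrite /node /osq expr_div_n -exprM mulrCA mulrA mulrC.
by rewrite [X in _ * X]mulrC mulrA.
Qed.

Lemma moment_tail m k : (0 < m)%N -> (2 * m < k)%N ->
  `|\sum_(j < m) weight m j * node m j ^+ k| <= 2 * m%:R / 4 ^+ m.
Proof.
move=> m0 mk; apply: (le_trans (ler_norm_sum _ _ _)).
apply: (@le_trans _ _ (\sum_(j < m) 2 / 4 ^+ m)); last first.
  by rewrite sumr_const card_ord -mulrnAl mulr_natr.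
apply: ler_sum => j _; have n0 := node_gt0 j m0.
case: k mk => // k mk; rewrite /weight exprS mulrA divfK ?gt_eqF//.
rewrite normrM ler_pM ?lag0_le2// ger0_norm ?exprn_ge0//; last exact: ltW.
have -> : 4 ^- m = (2^-1) ^+ (2 * m) :> R.
  by rewrite exprM exprVn expr2 -natrM exprVn.
apply: (@le_trans _ _ (2^-1 ^+ k)).
  rewrite lerXn2r ?nnegrE ?invr_ge0//; first exact: ltW.
  exact: node_le_half.
by rewrite ler_wiXn2l ?invr_ge0 ?invf_le1 ?ler1n//; lia.
Qed.

Lemma moment_bound m k : (0 < m)%N ->
  `|\sum_(j < m) weight m j / 2 * (node m j ^+ k - (- node m j) ^+ k)
    - (k == 1%N)%:R| <= 2 * m%:R / 4 ^+ m.
Proof.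
move=> m0; have b0 : 0 <= 2 * m%:R / 4 ^+ m :> R.
  by rewrite divr_ge0 ?mulr_ge0 ?exprn_ge0.
have [ok|ek] := boolP (odd k); last first.
  rewrite big1 => [|j _]; last first.
    by rewrite exprNn -signr_odd (negPf ek) mul1r subrr mulr0.
  by have -> : (k == 1)%N = false; [case: k ek => [|[]]|rewrite subrr normr0].
rewrite (eq_bigr (fun j : 'I_m => weight m j * node m j ^+ k)); last first.
  by move=> j _; rewrite exprNn -signr_odd ok expr1 mulN1r opprK; field.
have kE : k = (2 * k./2).+1 by rewrite mul2n -[LHS]odd_double_half ok.
have [km|mk] := ltnP k./2 m; last first.
  have -> : (k == 1)%N = false by lia.
  by rewrite subr0 moment_tail//; lia.
rewrite {1}kE moment_odd// lag0_sum//.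
have -> : (k == 1)%N = (k./2 == 0)%N by lia.
by case: eqP => [->|_]; rewrite ?mulr0 ?muln0 ?expr0 ?invr1 ?mulr1 subrr normr0.
Qed.

End interpolation.

(** A Bernstein inequality at the origin: a polynomial bounded by M on [-1, 1]
    whose coefficients have total mass A behaves, up to an error of order
    A / 4 ^ m and whatever its degree, like a polynomial of degree [2 * m]. *)
Lemma linear_coef_le {R : realType} (N m : nat) (c : nat -> R[i]) (M A : R) :
  (0 < m)%N -> (1 < N)%N ->
  (forall t : R, `|t| <= 1 -> cabs (\sum_(k < N) c k * t%:C%C ^+ k) <= M) ->
  \sum_(k < N) cabs (c k) <= A ->
  cabs (c 1%N) <= m%:R * (16 * M + 2 * A / 4 ^+ m).
Proof.
move=> m0 N1 QM cA.
pose Q (t : R) := \sum_(k < N) c k * t%:C%C ^+ k.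
pose w (k : nat) : R :=
  \sum_(j < m) weight m j / 2 * (node m j ^+ k - (- node m j) ^+ k).
have QE : \sum_(j < m) (weight m j / 2)%:C%C * (Q (node m j) - Q (- node m j)) =
    \sum_(k < N) c k * (w k)%:C%C.
  under eq_bigr do rewrite /Q -sumrB mulr_sumr.
  rewrite exchange_big; apply: eq_bigr => k _.
  rewrite /w rmorph_sum mulr_sumr; apply: eq_bigr => j _ /=.
  by rewrite [in RHS](realcM (weight m j / 2)) realcB !realcX; ring.
have wc : \sum_(k < N) c k * (w k)%:C%C =
    c 1%N + \sum_(k < N) c k * (w k - (k == 1 :> nat)%:R)%:C%C.
  have -> : c 1%N = \sum_(k < N) c k * ((k == 1 :> nat)%:R : R)%:C%C.
    rewrite (bigD1 (Ordinal N1))//= mulr1 big1 ?addr0// => k.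
    by rewrite -val_eqE /= => /negPf ->; rewrite mulr0.
  rewrite -big_split; apply: eq_bigr => k _ /=.
  by rewrite -mulrDr -realcD addrC subrK.
have -> : c 1%N =
    \sum_(j < m) (weight m j / 2)%:C%C * (Q (node m j) - Q (- node m j)) -
    \sum_(k < N) c k * (w k - (k == 1 :> nat)%:R)%:C%C.
  by rewrite QE wc addrK.
have M0 : 0 <= M.
  by apply: le_trans (QM 0 _); [exact: cabs_ge0|rewrite normr0].
apply: le_trans (cabsD _ _) _; rewrite cabsN mulrDr; apply: lerD.
  rewrite (le_trans (cabs_sum _ _ _))//.
  apply: (@le_trans _ _ (\sum_(j < m) `|weight m j| * M)); last first.
    rewrite -mulr_suml mulrA mulrC [m%:R * _]mulrC mulrC ler_wpM2r//.
    exact: sum_weight_le.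
  apply: ler_sum => j _; rewrite cabsM cabs_real normrM.
  rewrite [X in _ * X * _]ger0_norm//.
  have n0 : 0 < node m j :> R by exact: node_gt0.
  have n1 : `|node m j| <= 1 :> R.
    by rewrite gtr0_norm// (le_trans (node_le_half _))// invf_le1// ler1n.
  have h1 := QM _ n1; have h2 := QM (- node m j); rewrite normrN in h2.
  have {}h2 := h2 n1.
  rewrite -mulrA ler_wpM2l// ler_pdivrMl//.
  apply: le_trans (cabsD _ _) _; rewrite cabsN mulr_natl mulr2n.
  exact: lerD h1 h2.
rewrite (le_trans (cabs_sum _ _ _))//.
apply: (@le_trans _ _ (\sum_(k < N) cabs (c k) * (2 * m%:R / 4 ^+ m))).
  apply: ler_sum => k _; rewrite cabsM ler_wpM2l ?cabs_ge0// cabs_real.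
  exact: moment_bound.
rewrite -mulr_suml.
have -> : m%:R * (2 * A / 4 ^+ m) = A * (2 * m%:R / 4 ^+ m) by ring.
by rewrite ler_wpM2r// divr_ge0 ?mulr_ge0 ?exprn_ge0.
Qed.

(** With m about 1 + ln (A / M), the error term A / 4 ^ m is at most M. *)
Lemma linear_coef_le_ln {R : realType} (N : nat) (c : nat -> R[i]) (M A : R) :
  0 < M -> M <= A -> (1 < N)%N ->
  (forall t : R, `|t| <= 1 -> cabs (\sum_(k < N) c k * t%:C%C ^+ k) <= M) ->
  \sum_(k < N) cabs (c k) <= A ->
  cabs (c 1%N) <= 18 * M * (1 + ln (A / M)).
Proof.
move=> M0 MA N1 QM cA; have A0 : 0 < A by exact: lt_le_trans MA.
have r1 : 1 <= A / M by rewrite ler_pdivlMr// mul1r.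
pose x := ln (A / M); have x0 : 0 <= x by exact: ln_ge0.
pose m := (Num.truncn x).+1.
have mx : m%:R <= 1 + x.
  by rewrite /m -natr1 addrC lerD2l truncn_le.
have e4 : expR 1 <= 4 :> R.
  have := expR_ge1Dx (- (1 / 2) : R); rewrite expRN => h.
  have h2 : expR (1 / 2) <= 2 :> R.
    rewrite -[leLHS]invrK -[leRHS]invrK lef_pV2 ?posrE ?invr_gt0 ?expR_gt0//.
    by apply: le_trans h; lra.
  rewrite [X in expR X]splitr expRD.
  have -> : 4 = 2 * 2 :> R by rewrite -natrM.
  by apply: ler_pM; rewrite ?expR_ge0.
have A4 : A / 4 ^+ m <= M.
  rewrite ler_pdivrMr ?exprn_gt0// mulrC -ler_pdivrMr//.
  rewrite -[A / M]lnK ?posrE ?(lt_le_trans ltr01 r1)// -/x.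
  apply: (@le_trans _ _ (expR (m%:R))).
    by rewrite ler_expR ltW// truncnS_gt.
  rewrite -[m%:R]mulr1 mulrC expRM_natr lerXn2r ?nnegrE ?expR_ge0//.
have h : 16 * M + 2 * A / 4 ^+ m <= 18 * M.
  by rewrite -mulrA; move: (A / 4 ^+ m) A4 => B; lra.
have m0 : (0 < m)%N by [].
apply: le_trans (linear_coef_le m0 N1 QM cA) _.
apply: le_trans (ler_wpM2l (ler0n R m) h) _.
by rewrite mulrC; apply: ler_wpM2l => //; apply: mulr_ge0 => //; exact: ltW.
Qed.

(** * Riesz products over dissociated characters *)

Lemma coef01_prod {A : comNzRingType} (I : Type) (r : seq I) (a : I -> A) :
  (\prod_(i <- r) (1 + a i *: 'X))`_0 = 1 /\
  (\prod_(i <- r) (1 + a i *: 'X))`_1 = \sum_(i <- r) a i.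
Proof.
elim: r => [|i r [IH0 IH1]]; first by rewrite !big_nil !coefC.
rewrite !big_cons !mulrDl !mul1r !coefD -!scalerAl !coefZ !coefXM /=.
by rewrite IH0 IH1 mulr0 mulr1 addr0 addrC.
Qed.

Section words.
Context {R : realType} {G : topologicalZmodType} {n : nat}.
Implicit Types (l : 'I_n -> dual R G) (m : {ffun 'I_n -> 'I_3}).

(** The letters 0, 1, 2 stand for the coefficients -1, 0, 1. *)
Definition letter_dual (o : 'I_3) (gamma : dual R G) : dual R G :=
  if nat_of_ord o == 0%N then - gamma
  else if nat_of_ord o == 1%N then 0 else gamma.

Definition letter (o : 'I_3) (z : R[i]) : R[i] :=
  if nat_of_ord o == 0%N then conjc z else if nat_of_ord o == 1%N then 1 else z.

Definition weight_of m : nat := (\sum_i (nat_of_ord (m i) != 1))%N.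

Definition word_char l m : dual R G := \sum_i letter_dual (m i) (l i).

Definition word_coef (om : 'I_n -> R[i]) m : R[i] :=
  2^-1 ^+ weight_of m * \prod_i letter (m i) (om i).

Definition empty_word : {ffun 'I_n -> 'I_3} := [ffun=> inord 1].

(** As the coefficients are only -1, 0 and 1, several words may still represent
    the same nontrivial character. *)
Definition dissociated l : Prop :=
  forall m, word_char l m = 0 -> m = empty_word.

Lemma letterM o z w : letter o (z * w) = letter o z * letter o w.
Proof. by rewrite /letter; do 2?case: ifP => _; rewrite ?conjcM ?mulr1. Qed.

Lemma letter_dualE o (gamma : dual R G) x :
  letter_dual o gamma x = letter o (gamma x).
Proof.
by rewrite /letter /letter_dual; do 2?case: ifP => _//; rewrite characterV.
Qed.

Lemma dual_sumE (J : Type) (r : seq J) (F : J -> dual R G) x :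
  (\sum_(i <- r) F i) x = \prod_(i <- r) F i x.
Proof. by elim: r => [|i r IH]; rewrite ?big_nil// !big_cons -IH. Qed.

Lemma word_charE l m x : word_char l m x = \prod_i letter (m i) (l i x).
Proof.
by rewrite dual_sumE; apply: eq_bigr => i _; exact: letter_dualE.
Qed.

Lemma weight_empty_word : weight_of empty_word = 0%N.
Proof. by rewrite /weight_of big1// => i _; rewrite ffunE inordK. Qed.

Lemma word_coef_empty om : word_coef om empty_word = 1.
Proof.
rewrite /word_coef weight_empty_word expr0 mul1r big1// => i _.
by rewrite ffunE /letter inordK.
Qed.

Lemma weight_of_lt m : (weight_of m < n.+1)%N.
Proof.
rewrite ltnS -[leqRHS]card_ord -sum1_card leq_sum// => i _.
by case: (_ != _).
Qed.

(** The factors of the Riesz product, and the product as a polynomial in the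
    dilation parameter. *)
Definition cosine l om i x : R[i] :=
  2^-1 * (om i * l i x + conjc (om i * l i x)).

Definition riesz l om x : {poly R[i]} := \prod_i (1 + cosine l om i x *: 'X).

Lemma riesz_expand l om x :
  riesz l om x =
  \sum_m (word_coef om m * word_char l m x) *: 'X^(weight_of m).
Proof.
rewrite /riesz.
rewrite (eq_bigr (fun i => \sum_(o < 3)
   (2^-1 ^+ (nat_of_ord o != 1%N) * letter o (om i * l i x)) *:
   'X^(nat_of_ord o != 1%N))).
  rewrite bigA_distr_bigA; apply: eq_bigr => m _.
  rewrite scaler_prod -expr_sum; congr (_ *: _).
  rewrite big_split /= -expr_sum /word_coef word_charE -mulrA -big_split /=.
  by congr (_ * _); apply: eq_bigr => i _; rewrite letterM.
move=> i _; rewrite !big_ord_recr big_ord0 /= add0r /letter /= !expr1 expr0.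
by rewrite mulr1 scale1r /cosine mulrDr scalerDl addrA addrC addrA.
Qed.

Lemma coef_riesz l om x k : (riesz l om x)`_k =
  \sum_(m | weight_of m == k) word_coef om m * word_char l m x.
Proof.
rewrite riesz_expand coef_sum [RHS]big_mkcond; apply: eq_bigr => m _ /=.
by rewrite coefZ coefXn eq_sym; case: eqP => _; rewrite ?mulr1 ?mulr0.
Qed.

Lemma size_riesz l om x : (size (riesz l om x) <= n.+1)%N.
Proof.
rewrite riesz_expand (leq_trans (size_sum _ _ _))//; apply/bigmax_leqP => m _.
by rewrite (leq_trans (size_scale_leq _ _))// size_polyXn weight_of_lt.
Qed.

Lemma cosineE l om i x : cosine l om i x = (complex.Re (om i * l i x))%:C%C.
Proof.
rewrite /cosine addcJ mulrA mulVf ?mul1r// pnatr_eq0//.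
Qed.

Lemma riesz_ge0 l om x (t : R) : (forall i, cabs (om i) = 1) -> `|t| <= 1 ->
  exists2 r : R, 0 <= r & (riesz l om x).[t%:C%C] = r%:C%C.
Proof.
move=> om1 t1; exists (\prod_i (1 + complex.Re (om i * l i x) * t)).
  apply: prodr_ge0 => i _.
  have : `|complex.Re (om i * l i x) * t| <= 1.
    rewrite normrM -[leRHS]mulr1 ler_pM// (le_trans (Re_le_cabs _))//.
    by rewrite cabsM om1 cabs_character mulr1.
  by rewrite ler_norml => /andP[]; lra.
rewrite horner_prod rmorph_prod; apply: eq_bigr => i _ /=.
by rewrite hornerD hornerZ hornerX hornerC cosineE realcD realcM.
Qed.

End words.

Section riesz_products.
Context {R : realType} {G : topologicalZmodType} {n : nat}.
Variable mu : probability (borel G) R.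
Hypotheses (cG : compact [set: G]) (haar : is_haar mu).
Local Notation I := (cintegral mu).
Local Notation bm := (@bm R G).
Implicit Types (l : 'I_n -> dual R G) (m : {ffun 'I_n -> 'I_3}).

Let cbm f : cont f -> bm f.
Proof. exact: cont_bm. Qed.

Let bchi (chi : dual R G) : bm chi.
Proof. by apply: cbm; exact: cont_character. Qed.

Lemma riesz_hornerE l om x (t : R[i]) : (riesz l om x).[t] =
  \sum_m word_coef om m * t ^+ weight_of m * word_char l m x.
Proof.
rewrite riesz_expand horner_sum; apply: eq_bigr => m _.
by rewrite hornerZ hornerXn mulrAC.
Qed.

Lemma bm_riesz l om (t : R[i]) : bm (fun x => (riesz l om x).[t]).
Proof.
apply: (@eq_bm _ _ (fun x => \sum_m word_coef om m * t ^+ weight_of m *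
  word_char l m x)) => [x|]; first by rewrite riesz_hornerE.
by apply: bm_sum => m _; apply: bmZ.
Qed.

Lemma bm_coef_riesz l om k : bm (fun x => (riesz l om x)`_k).
Proof.
apply: (@eq_bm _ _ (fun x => \sum_(m | weight_of m == k)
  word_coef om m * word_char l m x)) => [x|]; first by rewrite coef_riesz.
by apply: bm_sum => m _; apply: bmZ.
Qed.

(** Only the empty word represents the trivial character. *)
Lemma int_riesz l om (t : R[i]) : dissociated l ->
  I (fun x => (riesz l om x).[t]) = 1.
Proof.
move=> dl; rewrite (@eq_int _ _ _ _ (fun x => \sum_m
    word_coef om m * t ^+ weight_of m * word_char l m x)); last first.
  by move=> x; rewrite riesz_hornerE.
rewrite int_sum => [|m _]; last exact: bmZ.
rewrite (bigD1 empty_word)//= big1 ?addr0 => [|m mn].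
  rewrite intZ// int_character// word_coef_empty weight_empty_word expr0.
  rewrite (_ : word_char l empty_word = 0) ?eqxx ?mulr1//.
  by rewrite /word_char big1// => i _; rewrite ffunE /letter_dual inordK.
rewrite intZ// int_character//; case: eqP => [/dl me|_]; last by rewrite mulr0.
by rewrite me eqxx in mn.
Qed.

(** The sum is the Fourier coefficient at gamma of the Riesz product with all
    phases and dilation equal to 1, a nonnegative function of mean one.  This
    controls all the words that represent gamma at once. *)
Lemma sum_words_le1 l gamma : dissociated l ->
  \sum_(m | word_char l m == gamma) 2^-1 ^+ weight_of m <= 1 :> R.
Proof.
move=> dl; pose om (i : 'I_n) : R[i] := 1.
have om1 i : cabs (om i) = 1 by exact: cabs1.
have omE m : word_coef om m = (2^-1 ^+ weight_of m)%:C%C.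
  rewrite /word_coef big1 ?mulr1 => [|i _].
    by rewrite realcX fmorphV rmorph_nat.
  by rewrite /letter /om; do 2?case: ifP => _//; rewrite conjc1.
have t1 : `|1 : R| <= 1 by rewrite normr1.
have E : fourier mu (fun x => (riesz l om x).[1%:C%C]) gamma =
    (\sum_(m | word_char l m == gamma) 2^-1 ^+ weight_of m)%:C%C.
  rewrite fourierE (@eq_int _ _ _ _ (fun x => \sum_m
      word_coef om m * (word_char l m x * conjc (gamma x)))); last first.
    move=> x; rewrite riesz_hornerE mulr_suml; apply: eq_bigr => m _.
    by rewrite expr1n mulr1 mulrA.
  rewrite int_sum => [|m _]; last by apply: bmZ; exact: bm_fourier.
  rewrite rmorph_sum [RHS]big_mkcond; apply: eq_bigr => m _ /=.
  rewrite intZ -?fourierE ?fourier_character//; last exact: bm_fourier.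
  by rewrite omE; case: eqP => _; rewrite ?mulr1 ?mulr0.
have s0 : 0 <= \sum_(m | word_char l m == gamma) 2^-1 ^+ weight_of m :> R.
  by apply: sumr_ge0 => m _; rewrite exprn_ge0// invr_ge0.
rewrite -[leLHS](ger0_norm s0) -cabs_real -E fourierE.
rewrite [leRHS](_ : 1 = complex.Re (I (fun x =>
    (cabs (riesz l om x).[1%:C%C])%:C%C))); last first.
  transitivity (complex.Re (I (fun x => (riesz l om x).[1%:C%C]))).
    by rewrite int_riesz.
  congr complex.Re; apply: eq_int => x.
  by have [r r0 ->] := riesz_ge0 l x om1 t1; rewrite cabs_real ger0_norm.
apply: int_le.
- by apply: bm_fourier => //; exact: bm_riesz.
- apply: (eq_bm _ (bm_riesz l om 1%:C%C)) => x.
  by have [r r0 ->] := riesz_ge0 l x om1 t1; rewrite cabs_real ger0_norm.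
- by move=> x; rewrite cabsM cabsJ cabs_character mulr1.
Qed.

Lemma int_mul_character f (chi : dual R G) :
  I (fun x => f x * chi x) = fourier mu f (- chi).
Proof. by apply: eq_int => x; rewrite characterV /= invrK. Qed.

Variables (f : G -> R[i]) (M A : R).
Hypotheses (bf : bm f) (fM : forall x, cabs (f x) <= M).
Hypothesis fA : A_norm mu f = A%:E.

Lemma sum_words_fourier_le l : dissociated l ->
  \sum_m 2^-1 ^+ weight_of m * cabs (fourier mu f (- word_char l m)) <= A.
Proof.
move=> dl; pose F gamma := cabs (fourier mu f gamma).
pose s := undup [seq - word_char l m | m : {ffun 'I_n -> 'I_3}].
have -> : \sum_m 2^-1 ^+ weight_of m * F (- word_char l m) =
    \sum_(gamma <- s) \sum_(m | - word_char l m == gamma)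
      2^-1 ^+ weight_of m * F gamma.
  rewrite (exchange_big_dep xpredT)//=; apply: eq_bigr => m _.
  rewrite -big_filter (eq_filter (a2 := pred1 (- word_char l m))); last first.
    by move=> gamma /=; rewrite eq_sym.
  rewrite filter_pred1_uniq ?undup_uniq ?big_seq1//.
  by rewrite mem_undup; apply: map_f; rewrite mem_enum.
apply: (@le_trans _ _ (\sum_(gamma <- s) F gamma)); last first.
  by apply: (finite_sum_le fA); exact: undup_uniq.
apply: ler_sum => gamma _; rewrite -mulr_suml.
rewrite -[leRHS]mul1r; apply: ler_wpM2r; first exact: cabs_ge0.
apply: le_trans (sum_words_le1 (- gamma) dl).
by rewrite le_eqVlt; apply/orP; left; apply/eqP; apply: eq_bigl => m;
  rewrite eqr_oppLR.
Qed.

Let coef l om k : R[i] := I (fun x => f x * (riesz l om x)`_k).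

Lemma sum_cabs_coef_le l om : dissociated l -> (forall i, cabs (om i) = 1) ->
  \sum_(k < n.+1) cabs (coef l om k) <= A.
Proof.
move=> dl om1; apply: le_trans (sum_words_fourier_le dl).
rewrite (partition_big (fun m => Ordinal (weight_of_lt m)) xpredT)//=.
apply: ler_sum => k _; rewrite /coef.
rewrite (@eq_int _ _ _ _ (fun x => \sum_(m | weight_of m == k)
    word_coef om m * (f x * word_char l m x))); last first.
  move=> x; rewrite coef_riesz mulr_sumr.
  by apply: eq_bigr => m _; rewrite mulrCA.
rewrite int_sum => [|m _]; last by apply: bmZ; exact: bmM.
rewrite (le_trans (cabs_sum _ _ _))//.
rewrite [leLHS](eq_bigl (fun m => Ordinal (weight_of_lt m) == k)); last first.
  by move=> m; rewrite -val_eqE.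
apply: ler_sum => m _; rewrite intZ; last exact: bmM.
rewrite int_mul_character cabsM; apply: ler_wpM2r; first exact: cabs_ge0.
rewrite /word_coef cabsM cabsX cabsV.
have -> : cabs (2 : R[i]) = 2.
  by rewrite (_ : 2 = (2 : R)%:C%C) ?cabs_real ?ger0_norm// rmorph_nat.
rewrite [X in _ * X](_ : _ = 1) ?mulr1//.
elim/big_ind: _ => [|x y x1 y1|i _]; first exact: cabs1.
  by rewrite cabsM x1 y1 mulr1.
by rewrite /letter; do 2?case: ifP => _; rewrite ?cabsJ ?cabs1.
Qed.

Lemma cabs_int_riesz_le l om (t : R) : dissociated l ->
  (forall i, cabs (om i) = 1) -> `|t| <= 1 ->
  cabs (\sum_(k < n.+1) coef l om k * t%:C%C ^+ k) <= M.
Proof.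
move=> dl om1 t1.
have M0 : 0 <= M by apply: le_trans (fM 0); exact: cabs_ge0.
have -> : \sum_(k < n.+1) coef l om k * t%:C%C ^+ k =
    I (fun x => f x * (riesz l om x).[t%:C%C]).
  rewrite (eq_bigr (fun k : 'I_n.+1 =>
      I (fun x => f x * (riesz l om x)`_k * t%:C%C ^+ k))); last first.
    move=> k _; rewrite /coef -intZr//.
    by apply: bmM => //; exact: bm_coef_riesz.
  rewrite -int_sum => [|k _]; last first.
    by apply: bmM; [apply: bmM => //; exact: bm_coef_riesz|exact: bm_cst].
  apply: eq_int => x.
  rewrite (horner_coef_wide _ (size_riesz l om x)) mulr_sumr.
  by apply: eq_bigr => k _; rewrite mulrA.
rewrite [leRHS](_ : M = complex.Re (I (fun x =>
    (M * cabs (riesz l om x).[t%:C%C])%:C%C))); last first.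
  rewrite (@eq_int _ _ _ _ (fun x => M%:C%C * (riesz l om x).[t%:C%C])).
    by rewrite intZ ?int_riesz ?mulr1//; exact: bm_riesz.
  move=> x; have [r r0 ->] := riesz_ge0 l x om1 t1.
  by rewrite cabs_real ger0_norm// realcM.
apply: int_le.
- by apply: bmM => //; exact: bm_riesz.
- apply: (eq_bm _ (bmZ M%:C%C (bm_riesz l om t%:C%C))) => x.
  have [r r0 ->] := riesz_ge0 l x om1 t1.
  by rewrite cabs_real ger0_norm// realcM.
- by move=> x; rewrite cabsM; apply: ler_wpM2r => //; exact: cabs_ge0.
Qed.

Lemma coef1E l om : coef l om 1%N = \sum_i 2^-1 *
  (om i * fourier mu f (- l i) + conjc (om i) * fourier mu f (l i)).
Proof.
rewrite /coef (@eq_int _ _ _ _ (fun x => \sum_i 2^-1 *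
  (om i * (f x * l i x) + conjc (om i) * (f x * conjc (l i x))))); last first.
  move=> x.
  have [_ ->] := coef01_prod (index_enum 'I_n) (fun i => cosine l om i x).
  by rewrite mulr_sumr; apply: eq_bigr => i _; rewrite /cosine conjcM; ring.
have b1 i : bm (fun x => f x * l i x) by exact: bmM.
have b2 i : bm (fun x => f x * conjc (l i x)) by exact: bm_fourier.
rewrite int_sum => [|i _]; last by apply: bmZ; apply: bmD; exact: bmZ.
apply: eq_bigr => i _; rewrite intZ; last by apply: bmD; exact: bmZ.
by rewrite intD ?intZ ?int_mul_character//; exact: bmZ.
Qed.

(** The integral of f against the Riesz product of dilation t is a polynomial in
    t that is bounded by M on [-1, 1] and whose coefficients have total mass at
    most A; its linear coefficient is controlled by the Bernstein inequality.
    That coefficient mixes the Fourier coefficients of f at [l i] and at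
    [- l i]; multiplying all the phases by the imaginary unit changes the
    relative sign of the two, and a combination of both choices isolates the
    coefficients at [l i]. *)
Lemma sum_fourier_dissociated_le l : dissociated l -> 0 < M -> M <= A ->
  \sum_i cabs (fourier mu f (l i)) <= 36 * M * (1 + ln (A / M)).
Proof.
move=> dl M0 MA.
have A0 : 0 <= ln (A / M) by rewrite ln_ge0// ler_pdivlMr// mul1r.
have [n0|n0] := posnP n.
  rewrite big1 => [|i]; last by have := ltn_ord i; rewrite [X in (_ < X)%N]n0.
  by apply: mulr_ge0; [apply: mulr_ge0 => //; exact: ltW|lra].
pose F i := fourier mu f (l i).
pose om i : R[i] := if F i == 0 then 1 else F i / (cabs (F i))%:C%C.
have om1 i : cabs (om i) = 1.
  rewrite /om; case: ifPn => [_|Fi]; first exact: cabs1.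
  by rewrite cabsM cabsV cabs_real ger0_norm ?cabs_ge0// divff// cabs_eq0.
have omF i : conjc (om i) * F i = (cabs (F i))%:C%C.
  rewrite /om; case: ifPn => [/eqP ->|Fi]; first by rewrite mulr0 cabs0.
  have c0 : (cabs (F i))%:C%C != 0 :> R[i].
    by rewrite eq_complex /= eqxx andbT cabs_eq0.
  rewrite conjcM conjc_inv conjc_real mulrAC [conjc _ * _]mulrC mulcJ.
  by rewrite expr2 realcM mulfK.
pose om' i := 'i%C * om i.
have om'1 i : cabs (om' i) = 1.
  by rewrite cabsM om1 mulr1 cabsE /= expr0n expr1n add0r sqrtr1.
have E : (\sum_i cabs (F i))%:C%C = coef l om 1%N + 'i%C * coef l om' 1%N.
  rewrite !coef1E mulr_sumr -big_split rmorph_sum; apply: eq_bigr => i _ /=.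
  rewrite -omF /om' conjcM.
  have -> : conjc 'i%C = - 'i%C :> R[i] by apply: eqcP; rewrite /= ?oppr0.
  have i2 : 'i%C * 'i%C = -1 :> R[i] by rewrite -expr2 sqr_i.
  rewrite -/(F i); move: (fourier mu f (- l i)) (F i) (om i) (conjc _) i2.
  move: ('i%C) => j a b w w' j2.
  have -> : j * (2^-1 * (j * w * a + - j * w' * b)) =
    2^-1 * (j * j * (w * a) - j * j * (w' * b)) by ring.
  by rewrite j2; field.
have S0 : 0 <= \sum_i cabs (F i) by apply: sumr_ge0 => i _; exact: cabs_ge0.
rewrite -[leLHS](ger0_norm S0) -cabs_real E.
apply: le_trans (cabsD _ _) _; rewrite cabsM.
have -> : cabs ('i%C : R[i]) = 1.
  by rewrite cabsE /= expr0n expr1n add0r sqrtr1.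
rewrite mul1r.
have bound o : (forall i, cabs (o i) = 1) ->
    cabs (coef l o 1%N) <= 18 * M * (1 + ln (A / M)).
  move=> o1; apply: (@linear_coef_le_ln R n.+1 (coef l o)) => //.
    by move=> t t1; exact: cabs_int_riesz_le.
  exact: sum_cabs_coef_le.
apply: le_trans (lerD (bound om om1) (bound om' om'1)) _.
by rewrite -mulrDl -mulrDl -natrD.
Qed.

End riesz_products.

(** * Spans of maximal dissociated sets *)

Section spans.
Context {R : realType} {G : topologicalZmodType}.
Implicit Types (s : seq (dual R G)) (gamma : dual R G).

Lemma letter_dual_mulz (o : 'I_3) gamma :
  letter_dual o gamma = gamma *~ ((o : nat)%:Z - 1).
Proof.
rewrite /letter_dual; case: o => -[|[|[|//]]] i /=.
- by rewrite sub0r mulrNz mulr1z.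
- by rewrite subrr mulr0z.
- by rewrite (_ : 2%:Z - 1 = 1)// mulr1z.
Qed.

Definition dissociated_seq s : Prop :=
  dissociated (fun i : 'I_(size s) => nth 0 s i).

Lemma dissociated_uniq s : dissociated_seq s -> uniq s.
Proof.
move=> ds; apply/(uniqP 0) => i j; rewrite !inE => si sj sij.
apply/eqP; apply/negPn/negP => ij.
pose i' := Ordinal si; pose j' := Ordinal sj.
have ij' : i' != j' by [].
(* The relation s_i - s_j = 0. *)
pose m : {ffun 'I_(size s) -> 'I_3} :=
  [ffun k => if k == i' then inord 2 else if k == j' then inord 0 else inord 1].
have /ds : word_char (fun k : 'I_(size s) => nth 0 s k) m = 0.
  rewrite /word_char (bigD1 i')//= (bigD1 j')//=; last by rewrite eq_sym.
  rewrite big1 ?addr0 => [|k /andP[ki kj]].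
    rewrite !ffunE eqxx [j' == i']eq_sym (negPf ij') eqxx.
    by rewrite /letter_dual !inordK//= sij subrr.
  by rewrite ffunE (negPf ki) (negPf kj) /letter_dual inordK.
move=> /ffunP/(_ i'); rewrite !ffunE eqxx => /(congr1 val)/=.
by rewrite !inordK.
Qed.

Lemma word_char_span s m : uniq s ->
  signed_span [set` s] (word_char (fun i : 'I_(size s) => nth 0 s i) m).
Proof.
move=> us.
pose c gamma : int := if insub (index gamma s) is Some i
  then (m i : nat)%:Z - 1 else 0.
exists c; split.
- move=> gamma; rewrite /c; case: insub => [i|]; last by rewrite !inE eqxx orbT.
  by case: (m i) => -[|[|[|//]]].
- apply: (@sub_finite_set _ _ [set` s]); first by move=> gamma [].
  exact: finite_seq.
- rewrite -fsbig_seq// (big_nth 0) big_mkord; apply: eq_bigr => i _.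
  rewrite letter_dual_mulz /c index_uniq// insubT //= => h.
  by congr (_ *~ (Posz (m _) - 1)); exact: val_inj.
Qed.

(** If appending a character destroys dissociativity, the offending relation
    involves that character, and can be solved for it. *)
Lemma not_dissociated_cons s gamma : dissociated_seq s ->
  ~ dissociated_seq (gamma :: s) -> signed_span [set` s] gamma.
Proof.
move=> ds nd; have us := dissociated_uniq ds.
have [m m0 mn] : exists2 m, word_char
    (fun i : 'I_(size (gamma :: s)) => nth 0 (gamma :: s) i) m = 0 &
    m <> empty_word.
  apply: contrapT => h; apply: nd => m m0; apply: contrapT => mn.
  by apply: h; exists m.
pose m' : {ffun 'I_(size s) -> 'I_3} := [ffun i => m (lift ord0 i)].
have mE : letter_dual (m ord0) gamma +
    word_char (fun i : 'I_(size s) => nth 0 s i) m' = 0.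
  rewrite -[RHS]m0 /word_char [RHS]big_ord_recl; congr (_ + _).
  by apply: eq_bigr => i _; rewrite ffunE.
have : m ord0 = inord 0 \/ m ord0 = inord 1 \/ m ord0 = inord 2.
  case: (m ord0) => -[|[|[|//]]] h; [left|right; left|right; right];
  by apply: val_inj; rewrite /= inordK.
case=> [mE0|[mE1|mE2]].
- move: mE; rewrite mE0 {1}/letter_dual inordK//= addrC => /eqP.
  rewrite subr_eq0 => /eqP <-; exact: word_char_span.
- exfalso; apply: mn; move: mE; rewrite mE1 {1}/letter_dual inordK//= add0r.
  move=> /ds m'E; apply/ffunP => i; rewrite ffunE.
  case: (unliftP ord0 i) => [j ->|->]; last by rewrite mE1.
  by have /ffunP/(_ j) := m'E; rewrite !ffunE.
- move: mE; rewrite mE2 {1}/letter_dual inordK//= => /eqP.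
  rewrite addr_eq0 => /eqP ->.
  (* The relation reads gamma = - word, and negation reverses the letters. *)
  have -> : - word_char (fun i : 'I_(size s) => nth 0 s i) m' =
      word_char (fun i : 'I_(size s) => nth 0 s i) [ffun i => rev_ord (m' i)].
    rewrite /word_char -sumrN; apply: eq_bigr => i _.
    rewrite !letter_dual_mulz [in RHS]ffunE -mulrNz; congr (_ *~ _).
    by rewrite /=; have := ltn_ord (m' i); lia.
  exact: word_char_span.
Qed.

(** Take a dissociated sequence of maximal length: no element of Gamma can be
    added to it. *)
Lemma exists_dissociated_span (Gamma : set (dual R G)) (B : R) :
  0 <= B ->
  (forall s, (forall gamma, gamma \in s -> Gamma gamma) -> dissociated_seq s ->
    (size s)%:R <= B) ->
  exists s, [/\ uniq s, (size s)%:R <= B & Gamma `<=` signed_span [set` s]].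
Proof.
move=> B0 hB.
pose good s := (forall gamma, gamma \in s -> Gamma gamma) /\ dissociated_seq s.
pose P n := `[< exists2 s, good s & size s = n >].
have P0 : exists n, P n.
  exists 0%N; apply/asboolP; exists [::] => //; split => // m _.
  by apply/ffunP => -[].
have PB n : P n -> (n <= Num.truncn B)%N.
  move=> /asboolP[s [sG ds] <-].
  by rewrite truncn_ge_nat // hB.
case: (ex_maxnP P0 PB) => n /asboolP[s [sG ds] sn] nmax.
exists s; split; [exact: dissociated_uniq|exact: hB|] => gamma Ggamma.
apply: not_dissociated_cons => // dgs.
have : (size (gamma :: s) <= n)%N.
  apply: nmax; apply/asboolP; exists (gamma :: s) => //; split => // chi.
  by rewrite inE => /orP[/eqP ->|/sG].
by rewrite /= sn ltnn.
Qed.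

End spans.

Theorem theorem2p2 (R : realType) :
  exists C : R, 0 < C /\
  forall (G : topologicalZmodType) (mu : probability (borel G) R)
         (f : borel G -> R[i]) (eps : R),
    compact [set: G] -> hausdorff_space G -> is_haar mu ->
    in_A mu f -> ~ {ae mu, forall x, f x = 0} ->
    0 < eps -> eps <= 1 ->
    exists L : set (dual R G),
      [/\ large_spectrum mu f eps `<=` signed_span L,
          finite_set L &
          #|` fset_set L|%fset%:R <=
            C * eps^-1 *
            (1 + ln (fine (A_norm mu f) * (fine (Linfty_norm mu f))^-1))].
Proof.
exists 36; split => // G mu f eps cG hG haar [fi fA] fn0 eps0 eps1.
have muT : (0 < mu [set: borel G])%E by rewrite probability_setT.
have LE : Linfty_norm mu f = ess_sup mu (abse \o (fun x => (cabs (f x))%:E)).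
  by rewrite /Linfty_norm unlock muT.
have L0 : (0 <= Linfty_norm mu f)%E by exact: Lnorm_ge0.
have fle : {ae mu, forall x : borel G, ((cabs (f x))%:E <= Linfty_norm mu f)%E}.
  rewrite LE.
  apply: filterS (ess_sup_ge mu (abse \o (fun x => (cabs (f x))%:E))).
  by move=> x /=; rewrite ger0_norm ?cabs_ge0.
have [Loo|Lfin] := eqVneq (Linfty_norm mu f) +oo%E.
  (* The large spectrum is empty, and the right-hand side is 36 / eps because
     both [fine +oo] and [ln 0] are 0. *)
  exists set0; split => //.
    move=> gamma; rewrite /large_spectrum /= Loo gt0_muley ?lte_fin//.
  rewrite fset_set0 cardfs0 Loo /= invr0 mulr0 ln0// addr0 mulr1.
  by rewrite mulr_ge0// invr_ge0 ltW.
pose M := fine (Linfty_norm mu f).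
have ME : Linfty_norm mu f = M%:E.
  by rewrite fineK// ge0_fin_numE// lt_neqAle Lfin leey.
pose A := fine (A_norm mu f).
have AE : A_norm mu f = A%:E.
  rewrite fineK// ge0_fin_numE//; apply: esum_ge0 => gamma _.
  by rewrite lee_fin cabs_ge0.
have M0 : 0 <= M by rewrite -lee_fin -ME.
have {}fle : {ae mu, forall x : borel G, cabs (f x) <= M}.
  by apply: filterS fle => x; rewrite ME lee_fin.
have Mpos : 0 < M.
  rewrite lt_neqAle M0 andbT eq_sym; apply/eqP => M00; apply: fn0.
  apply: filterS fle => x; rewrite M00 => h; apply/eqP.
  by rewrite -cabs_eq0 eq_le h cabs_ge0.
have [g [bg gM gf gF]] := truncate_bounded cG fi M0 fle.
have gA : A_norm mu g = A%:E.
  by rewrite -AE; apply: eq_esum => gamma _; rewrite gF.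
have MA : M <= A.
  have gleA := sup_le_A_norm cG haar hG bg gA.
  rewrite -lee_fin -ME LE; apply/ess_supP; near=> x.
  rewrite /= lee_fin ger0_norm ?cabs_ge0//.
  have <- : g x = f x by near: x.
  by near: x.
have ln0 : 0 <= ln (A / M) by rewrite ln_ge0// ler_pdivlMr// mul1r.
have [||s [us sB sG]] := @exists_dissociated_span R G (large_spectrum mu f eps)
    (36 * eps^-1 * (1 + ln (A / M))).
- by apply: mulr_ge0; [apply: mulr_ge0 => //; rewrite invr_ge0 ltW|lra].
- move=> s sG ds.
  have := sum_fourier_dissociated_le cG haar bg gM gA ds Mpos MA.
  have : (size s)%:R * (eps * M) <=
      \sum_(i < size s) cabs (fourier mu g (nth 0 s i)).
    rewrite -[X in X%:R * _]card_ord mulr_natl -sumr_const.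
    apply: ler_sum => i _; rewrite gF.
    have := sG (nth 0 s i) (mem_nth _ _).
    by rewrite /large_spectrum /= ME -EFinM lee_fin; apply.
  move=> /le_trans h /h.
  move=> hs; rewrite -(@ler_pM2r _ (eps * M)) ?mulr_gt0//.
  apply: le_trans hs _; rewrite le_eqVlt; apply/orP; left; apply/eqP.
  by field; rewrite gt_eqF.
exists [set` s]; split => //.
rewrite -/A -/M (le_trans _ sB)// ler_nat.
apply: uniq_leq_size => [|gamma]; first exact: fset_uniq.
have fs : finite_set [set` s] by exact: finite_seq.
by rewrite in_fset_set// => /set_mem.
Unshelve. all: by end_near. Qed.
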